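(* Let $(B,\cdot,\circ)$ be a finite left semi-brace such that $\rho$ is an anti-homomorphism, and let $K$ be a field. Then the monoid algebra $KM(B)$ is a (left and right) Noetherian PI-algebra (i.e. it satisfies a polynomial identity) of finite Gelfand-Kirillov dimension equal to that of $KM(1_{\circ}B1_{\circ})$. In particular, this dimension is at most $|1_{\circ}B1_{\circ}|$, and it is precisely equal to $|1_{\circ}B1_{\circ}|$ if $B$ is a left brace.
   Context: A left semi-brace is a set $B$ with two operations $\cdot$ and $\circ$ such that $(B,\cdot)$ is a semigroup, $(B,\circ)$ is a group, and $a\circ(bc)=(a\circ b)(a\circ(\overline{a}c))$ for all $a,b,c\in B$ (here $xy$ means $x\cdot y$ and $\overline{a}$ is the inverse of $a$ in $(B,\circ)$). The identity of $(B,\circ)$ is $1_{\circ}$, and $1_{\circ}B1_{\circ}=\{1_{\circ}b1_{\circ}\mid b\in B\}$. A left brace is a left semi-brace for which $(B,\cdot)$ is an abelian group. Maps: $\lambda_a(b)=a\circ(\overline{a}b)$ and $\rho_a(b)=\overline{(\overline{b}a)}\circ a$ for $a,b\in B$. $\rho:a\mapsto\rho_a$ is an anti-homomorphism if $\rho_{a\circ b}=\rho_b\rho_a$ (composition of maps) for all $a,b\in B$. In that case $r_B(x,y)=(\lambda_x(y),\rho_y(x))$ is a set-theoretic solution of the Yang-Baxter equation, and $1_{\circ}B1_{\circ}$ is a left subsemi-brace (in fact a skew left brace, i.e. a left semi-brace whose multiplicative semigroup is a group). The structure monoid $M(B)$ is the monoid with generating set $B$ and relations $x*y=u*v$ whenever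 $r_B(x,y)=(u,v)$. $M(1_{\circ}B1_{\circ})$ is defined in the same way from the left semi-brace $1_{\circ}B1_{\circ}$. $KM$ denotes the monoid algebra of $M$ over $K$. *)

(* Defs.v *)
From HB Require Import structures.
From mathcomp Require Import all_boot all_order all_algebra all_fingroup.
(* monalg must precede mathcomp-analysis: the other order is a syntax error. *)
From mathcomp Require Import finmap monalg.
From mathcomp Require Import all_classical all_reals all_analysis.

Set Implicit Arguments.
Unset Strict Implicit.
Unset Printing Implicit Defensive.

Import Order.TTheory GRing.Theory Num.Theory.

Local Open Scope group_scope.

(* The group (B, o) is carried by [finGroupType], so in group_scope [x * y],
   [x^-1] and [1] are x o y, the inverse and the identity of o; the semigroup
   product x . y is [x ** y]. *)
HB.mixin Record isLeftSemiBrace B of FinGroup B := {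
  sbmul : B -> B -> B;
  sbmulA : associative sbmul;
  sbmul_distr : forall a b c : B,
    (a * sbmul b c)%g = sbmul (a * b)%g (a * sbmul a^-1 c)%g
}.

#[short(type="finLeftSemiBraceType")]
HB.structure Definition FinLeftSemiBrace :=
  { B of FinGroup B & isLeftSemiBrace B }.

Notation "x ** y" := (sbmul x y) (at level 40, left associativity).

Section SemiBrace.
Variable B : finLeftSemiBraceType.
Implicit Types a b c x y : B.

Definition sb_lambda a b : B := a * (a^-1 ** b).
Definition sb_rho a b : B := (b^-1 ** a)^-1 * a.

Definition rho_antihom : Prop :=
  forall a b, sb_rho (a * b) =1 sb_rho b \o sb_rho a.

Definition sb_r (xy : B * B) : B * B :=
  (sb_lambda xy.1 xy.2, sb_rho xy.2 xy.1).

Definition is_left_brace : Prop :=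
  commutative (@sbmul B) /\
  exists e : B, left_id e (@sbmul B) /\ forall x, exists y, y ** x = e.

Definition corner : {set B} := [set 1 ** b ** 1 | b in B].

Lemma sbmul1m b c : b ** (1 ** c) = b ** c.
Proof. by have := sbmul_distr 1 b c; rewrite invg1 !mul1g. Qed.

Lemma sb_lambdaK a c : sb_lambda a (sb_lambda a^-1 c) = 1 ** c.
Proof.
have := sbmul_distr a^-1 1 c; rewrite mulg1 invgK => e.
by rewrite /sb_lambda invgK -e mulKVg.
Qed.

Definition rideal b : {set B} := [set b ** c | c in B].

Lemma mul_rideal a b : [set a * x | x in rideal b] = rideal (a * b).
Proof.
apply/setP=> z; apply/imsetP/imsetP.
  by case=> _ /imsetP[c _ ->] ->; exists (sb_lambda a c); rewrite // sbmul_distr.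
case=> c _ ->; exists (b ** sb_lambda a^-1 c); first by apply/imsetP; eexists.
by rewrite sbmul_distr -/(sb_lambda _ _) sb_lambdaK sbmul1m.
Qed.

Lemma card_rideal a : #|rideal a| = #|rideal 1|.
Proof.
by rewrite -[a in LHS]mulg1 -mul_rideal card_imset //; apply: mulgI.
Qed.

Lemma rideal_sub a : 1 ** a = a -> rideal a = rideal 1.
Proof.
move=> a1; apply/eqP; rewrite eqEcard card_rideal leqnn andbT.
apply/fintype.subsetP=> _ /imsetP[c _ ->]; apply/imsetP; exists (a ** c) => //.
by rewrite sbmulA a1.
Qed.

Lemma sbmul11 : (1 : B) ** 1 = 1.
Proof.
(* 1 is a product b c, since left translates of products are products *)
have [b [c bc]] : exists b c : B, b ** c = 1.
  exists ((1 ** 1)^-1 * 1), (sb_lambda (1 ** 1)^-1 1).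
  by rewrite -sbmul_distr mulVg.
have sub : rideal (1 : B) \subset rideal b.
  apply/fintype.subsetP=> _ /imsetP[x _ ->]; apply/imsetP; exists (c ** x) => //.
  by rewrite sbmulA bc.
have e : rideal 1 = rideal b by apply/eqP; rewrite eqEcard sub card_rideal /=.
have /imsetP[d _ d1] : (1 : B) \in rideal 1.
  by rewrite e; apply/imsetP; exists c.
by rewrite {2 3}d1 sbmul1m -d1.
Qed.

Lemma cornerP x : reflect (1 ** x = x /\ x ** 1 = x) (x \in corner).
Proof.
apply: (iffP imsetP) => [[b _ ->]|[e1 e2]].
  by rewrite !sbmulA sbmul11 -[_ ** 1 ** 1]sbmulA sbmul11.
by exists x; rewrite // e1 e2.
Qed.

Lemma corner_rinv x : x \in corner -> exists2 y, y \in corner & x ** y = 1.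
Proof.
move=> /cornerP[e1 e2].
have /imsetP[c _ c1] : (1 : B) \in rideal x.
  by rewrite rideal_sub //; apply/imsetP; exists 1; rewrite ?sbmul11.
exists (1 ** c ** 1); first by apply/imsetP; exists c.
by rewrite !sbmulA e2 -c1 sbmul11.
Qed.

Lemma corner_linv x : x \in corner -> exists2 y, y \in corner & y ** x = 1.
Proof.
move=> /[dup] xC /corner_rinv[y yC xy].
have [z zC yz] := corner_rinv yC; exists y => //.
have /cornerP[_ x1] := xC; have /cornerP[z1 _] := zC.
by rewrite -[x]x1 -yz [x ** (y ** z)]sbmulA xy z1 yz.
Qed.

Lemma cornerM x y : x \in corner -> y \in corner -> x ** y \in corner.
Proof.
move=> /cornerP[x1 _] /cornerP[_ y1].
by apply/cornerP; rewrite sbmulA x1 -sbmulA y1.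
Qed.

Lemma corner_group_set : group_set corner.
Proof.
apply/group_setP; split=> [|x y xC yC]; first by apply/cornerP; rewrite sbmul11.
have /cornerP[x1 xr] := xC; have /cornerP[y1 yr] := yC.
have lx1 : sb_lambda x 1 = 1.
  have e : x ** sb_lambda x 1 = x.
    have := sbmul_distr x 1 1; rewrite sbmul11 mulg1 => e.
    by rewrite /sb_lambda -e.
  have [z _ zx] := corner_linv xC.
  have e1 : 1 ** sb_lambda x 1 = sb_lambda x 1.
    have := mul_rideal x x^-1; rewrite mulgV => /setP/(_ (sb_lambda x 1)).
    have -> : sb_lambda x 1 \in [set x * t | t in rideal x^-1].
      by apply/imsetP; exists (x^-1 ** 1) => //; apply/imsetP; exists 1.
    by move=> /esym/imsetP[t _ ->]; rewrite sbmul1m.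
  by have := sbmulA z x (sb_lambda x 1); rewrite e zx e1.
apply/cornerP; split.
  have : x * y \in rideal (x * 1).
    rewrite -mul_rideal; apply/imsetP; exists y => //.
    by apply/imsetP; exists y.
  by rewrite mulg1 => /imsetP[t _ ->]; rewrite sbmulA x1.
by have := sbmul_distr x y 1; rewrite yr -/(sb_lambda _ _) lx1 => <-.
Qed.

Canonical corner_group := Group corner_group_set.

End SemiBrace.

Arguments rho_antihom : clear implicits.
Arguments is_left_brace : clear implicits.
Arguments sb_r : clear implicits.
Arguments corner : clear implicits.
Arguments corner_group : clear implicits.

(* 1_o B 1_o with the restrictions of both operations of B.  [subg] is the
   retraction of B onto the subtype: it is only applied to members. *)
Definition corner_sb (B : finLeftSemiBraceType) : Type :=
  subg_of (corner_group B).

Section CornerSemiBrace.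
Variable B : finLeftSemiBraceType.

HB.instance Definition _ := FinGroup.on (corner_sb B).

Definition corner_sbmul (x y : corner_sb B) : corner_sb B :=
  subg (corner_group B) (sgval x ** sgval y).

Lemma val_corner_sbmul x y : sgval (corner_sbmul x y) = sgval x ** sgval y.
Proof. by apply: subgK; apply: cornerM; apply: subgP. Qed.

Lemma corner_sbmulA : associative corner_sbmul.
Proof. by move=> x y z; apply: subg_inj; rewrite !val_corner_sbmul sbmulA. Qed.

Lemma corner_sbmul_distr (a b c : corner_sb B) :
  a * corner_sbmul b c = corner_sbmul (a * b) (a * corner_sbmul a^-1 c).
Proof.
apply: subg_inj; rewrite val_corner_sbmul /= !val_corner_sbmul.
exact: sbmul_distr.
Qed.

HB.instance Definition _ := isLeftSemiBrace.Build (corner_sb B)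
  corner_sbmulA corner_sbmul_distr.

End CornerSemiBrace.

Section StructureMonoid.
Variables (X : choiceType) (r : X * X -> X * X).

Inductive word_cong : seq X -> seq X -> Prop :=
| WCrel x y u v : r (x, y) = (u, v) -> word_cong [:: x; y] [:: u; v]
| WCrefl s : word_cong s s
| WCsym s t : word_cong s t -> word_cong t s
| WCtrans s t w : word_cong s t -> word_cong t w -> word_cong s w
| WCcat s s' t t' :
    word_cong s s' -> word_cong t t' -> word_cong (s ++ t) (s' ++ t').

Lemma word_cong_size s t : word_cong s t -> size s = size t.
Proof.
elim=> // [s1 s2 w _ -> _ -> //|s1 s2 t1 t2 _ e1 _ e2].
by rewrite !size_cat e1 e2.
Qed.

Definition word_congb : rel (seq X) := fun s t => `[< word_cong s t >].

Lemma word_congb_equiv : equiv_class_of word_congb.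
Proof.
split=> [s|s t|t s w].
- by apply/asboolP; apply: WCrefl.
- by apply/asboolP/asboolP; apply: WCsym.
- by move=> /asboolP st /asboolP tw; apply/asboolP; apply: WCtrans st tw.
Qed.

Canonical word_congb_equiv_rel := EquivRelPack word_congb_equiv.

Definition struct_monoid := {eq_quot word_congb}%qT.

HB.instance Definition _ := Choice.on struct_monoid.

Definition struct_word (s : seq X) : struct_monoid := (\pi s)%qT.

Definition struct_mul (x y : struct_monoid) : struct_monoid :=
  struct_word (generic_quotient.repr x ++ generic_quotient.repr y).

Lemma struct_wordP s t : struct_word s = struct_word t <-> word_cong s t.
Proof.
split=> [/eqmodP/asboolP //|st]; apply/eqmodP/asboolP; exact: st.
Qed.

Lemma struct_wordK x : struct_word (generic_quotient.repr x) = x.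
Proof. exact: reprK. Qed.

Lemma struct_mul_word s t :
  struct_mul (struct_word s) (struct_word t) = struct_word (s ++ t).
Proof. by apply/struct_wordP/WCcat; apply/struct_wordP/struct_wordK. Qed.

Lemma struct_mulA : associative struct_mul.
Proof.
move=> x y z; rewrite -[x]struct_wordK -[y]struct_wordK -[z]struct_wordK.
by rewrite !struct_mul_word catA.
Qed.

Lemma struct_mul1m : left_id (struct_word [::]) struct_mul.
Proof. by move=> x; rewrite -[x]struct_wordK struct_mul_word. Qed.

Lemma struct_mulm1 : right_id (struct_word [::]) struct_mul.
Proof. by move=> x; rewrite -[x]struct_wordK struct_mul_word cats0. Qed.

Lemma struct_unitm x y : struct_mul x y = struct_word [::] ->
  x = struct_word [::] /\ y = struct_word [::].
Proof.
rewrite -[x]struct_wordK -[y]struct_wordK struct_mul_word.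
move=> /struct_wordP/word_cong_size; rewrite size_cat /= => /eqP.
by rewrite addn_eq0 !size_eq0 => /andP[/eqP-> /eqP->].
Qed.

HB.instance Definition _ := Choice_isMonomialDef.Build struct_monoid
  struct_mulA struct_mul1m struct_mulm1 struct_unitm.

End StructureMonoid.

Definition sb_monoid (B : finLeftSemiBraceType) : monomType :=
  struct_monoid (sb_r B).

Local Open Scope ring_scope.
Local Open Scope classical_set_scope.

Section MonoidAlgebra.
Variables (K : fieldType) (M : monomType).

Lemma malg_scalerAr (c : K) (f g : {malg K[M]}) : c *: (f * g) = f * (c *: g).
Proof.
apply/malgP=> m.
rewrite mcoeffZ mcoeffMl (mcoeffMlw _ (fsubset_refl _) (msuppZ_le _ _)).
rewrite mulr_sumr; apply: eq_bigr => i _; rewrite mulr_sumr.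
by apply: eq_bigr => j _; rewrite mcoeffZ mulrnAr mulrCA.
Qed.

(* The alias is needed because monalg reserves the algType instance of [malg]
   for commutative monoids. *)
Definition monoid_algebra : Type := {malg K[M]}.

HB.instance Definition _ := GRing.Lalgebra.on monoid_algebra.
HB.instance Definition _ := GRing.Lalgebra_isAlgebra.Build K monoid_algebra
  malg_scalerAr.

End MonoidAlgebra.

Section Noetherian.
Variable A : nzRingType.

Definition left_ideal (I : set A) : Prop :=
  [/\ I 0, forall x y, I x -> I y -> I (x - y) & forall a x, I x -> I (a * x)].

Definition right_ideal (I : set A) : Prop :=
  [/\ I 0, forall x y, I x -> I y -> I (x - y) & forall x a, I x -> I (x * a)].

Definition acc (P : set (set A)) : Prop :=
  forall I : nat -> set A, (forall n, P (I n)) -> (forall n, I n `<=` I n.+1) ->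
  exists N, forall n, (N <= n)%N -> I n = I N.

Definition left_noetherian : Prop := acc left_ideal.
Definition right_noetherian : Prop := acc right_ideal.

End Noetherian.

Section Algebra.
Variables (R : realType) (K : fieldType) (A : algType K).

Definition ncpoly_eval n (f : {malg K[{fmonom 'I_n}]}) (a : 'I_n -> A) : A :=
  mmap (in_alg A) (fun w : {fmonom 'I_n} => \prod_(i <- w) a i) f.

Definition is_PI : Prop :=
  exists n (f : {malg K[{fmonom 'I_n}]}),
    f != 0 /\ forall a : 'I_n -> A, ncpoly_eval f a = 0.

Definition lspan (S : set A) : set A :=
  [set x | exists n (c : 'I_n -> K) (a : 'I_n -> A),
     (forall i, S (a i)) /\ x = \sum_i c i *: a i].

Definition lin_indep n (e : 'I_n -> A) : Prop :=
  forall c : 'I_n -> K, \sum_i c i *: e i = 0 -> forall i, c i = 0.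

Definition has_dim (V : set A) (n : nat) : Prop :=
  exists e : 'I_n -> A, lin_indep e /\ lspan (range e) = V.

Definition fin_dim (V : set A) : Prop := exists n, has_dim V n.

(* The dimension of V; the default value 0 is taken when V is not
   finite-dimensional. *)
Definition ldim (V : set A) : nat := xget 0%N (has_dim V).

(* K + V + V^2 + ... + V^n *)
Definition pow_sum (V : set A) (n : nat) : set A :=
  lspan [set x | exists s : seq A,
     [/\ (size s <= n)%N, {in s, forall y, V y} & x = \prod_(y <- s) y]].

(* sup over the finite-dimensional subspaces V of
   limsup_n log_n dim(K + V + ... + V^n); the terms n = 0, 1, where ln n = 0,
   do not affect the limsup. *)
Definition GKdim : \bar R :=
  ereal_sup [set limn_esup
      (fun n => (ln (ldim (pow_sum V n))%:R / ln (n%:R : R))%:E) |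
    V in fin_dim].

End Algebra.

Arguments is_PI : clear implicits.
Arguments GKdim : clear implicits.

(* Main.v *)
Require Import Defs.
From HB Require Import structures.
From mathcomp Require Import all_boot all_order all_algebra all_fingroup.
From mathcomp Require Import cyclic finmap monalg.
From mathcomp Require Import all_classical all_reals all_analysis.

Import Order.TTheory GRing.Theory Num.Theory.

(** Write C for the corner, a group under the product [**], let B act on it by
    the automorphisms [lact], and put [kappa x = 1 ** x ** 1].  The hypothesis
    on rho says that kappa is a 1-cocycle from the group B to C.  To a word
    x1 ... xn of B attach its coordinates, the elements
    [lact (x1 * ... * x(i-1)) (kappa xi)] of C, and its product
    x1 * ... * xn in the group B.  In coordinates a defining relation of the
    structure monoid M(B) replaces two neighbours g, h by h, g ^ h, and it does
    not change the product; conversely the coordinates together with the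
    product determine the element of M(B) ([coord_inj]).  So M(B) is the monoid
    of pairs (a, p) in the semidirect product of B with the conjugation monoid
    of the group C, restricted to the unit and to those pairs with a nonempty a
    for which kappa p is the product of a.

    Let q be the order of C.  Conjugation by [c ^+ q] is trivial, hence the
    block made of q letters c can be moved across everything, and it has product
    1.  The corresponding elements z_c of M(B), one for each c in C, therefore
    satisfy m z_c = z_(p.c) m, where p is the product of m; in particular they
    commute with each other.  In a word with more than q * q letters some c
    occurs q times among the coordinates, and these occurrences can be collected
    in front: a long element of M(B) is divisible by some z_c.  Thus M(B) is the
    product of the commutative monoid generated by the z_c with a finite set,
    on either side ([sb_monoid_normal_gen]).

    Everything about the algebra follows from this.  It is a finite module over
    the polynomial algebra in the z_c acting on the left, and also on the right,
    so Hilbert's basis theorem makes it Noetherian ([noeth_generated]).  A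
    multilinear identity of degree n exists as soon as n! exceeds the number
    of linear conditions on its coefficients; as an element is given up to
    exponents by finitely many data, there are only d ^ n conditions, for a
    constant d ([normal_gen_PI]).  The number of elements of length at most n is
    O(n ^ #|C|), which bounds the Gelfand-Kirillov dimension
    ([normal_gen_ball], [GKdimE]).

    For the equality of dimensions, every nonempty word is congruent to a word
    whose letters but the last lie in C, so the balls of M(B) are at most
    #|B| + 1 times as large as those of M(C); and rewriting a word of B as the
    word of C with the same coordinates is a left inverse of the map from M(C)
    to M(B), which is therefore injective ([transport]).  Finally, if [**] is
    commutative, the relations only permute the coordinates, so the multiset of
    coordinates is an invariant and the balls have at least the size of those
    of a free commutative monoid of rank #|C| ([ball_ge_brace]). *)

Set Implicit Arguments.
Unset Strict Implicit.
Unset Printing Implicit Defensive.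

Local Open Scope group_scope.

(** * The twisting maps of a left semi-brace *)

Section SemiBraceLambda.
Variable B : finLeftSemiBraceType.
Implicit Types (a b c p x y : B).

Lemma sb_lambdaM a b c : sb_lambda (a * b) c = sb_lambda a (sb_lambda b c).
Proof.
have := sbmul_distr b (b^-1 * a^-1) c.
by rewrite mulKVg /sb_lambda -invMg -mulgA => ->.
Qed.

Lemma sb_lambda_morph p : {morph sb_lambda p : b c / b ** c}.
Proof. by move=> b c; rewrite /sb_lambda -sbmul_distr sbmulA. Qed.

Lemma sb_lambda1 b : sb_lambda 1 b = 1 ** b.
Proof. by rewrite /sb_lambda invg1 mul1g. Qed.

Lemma sbmul1_lambda p b : 1 ** sb_lambda p b = sb_lambda p b.
Proof. by rewrite -sb_lambda1 -sb_lambdaM mul1g. Qed.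

Lemma sb_lambda_1mul p b : sb_lambda p (1 ** b) = sb_lambda p b.
Proof. by rewrite -sb_lambda1 -sb_lambdaM mulg1. Qed.

(** [sb_lambda p 1] is an idempotent of the right ideal generated by 1, so its
    image in the corner is an idempotent of a group. *)
Lemma sb_lambda_unit p : sb_lambda p 1 ** 1 = 1.
Proof.
have fC : sb_lambda p 1 ** 1 \in corner B.
  by apply/cornerP; rewrite sbmulA sbmul1_lambda -sbmulA sbmul11.
have ff : sb_lambda p 1 ** 1 ** (sb_lambda p 1 ** 1) = sb_lambda p 1 ** 1.
  by rewrite -sbmulA [1 ** (_ ** 1)]sbmulA sbmul1_lambda sbmulA
             -sb_lambda_morph sbmul11.
have [z zC fz] := corner_linv fC.
have /cornerP[f1 _] := fC.
by rewrite -[LHS]f1 -{1}fz -sbmulA ff fz.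
Qed.

(** This is the only use of the hypothesis on rho: evaluating the
    anti-homomorphism rule at 1 and cancelling gives the identity. *)
Lemma rho_antihom_cocycle x y : rho_antihom B ->
  1 ** (x * y) = 1 ** x ** sb_lambda x y.
Proof.
move=> /(_ x y 1) /=; rewrite /sb_rho invg1 mulgA => /mulIg.
set u := 1 ** (x * y) => e.
have {e}-> : u = x * (((1 ** x)^-1 * x)^-1 ** y).
  have -> : u = x * (u^-1 * x)^-1 by rewrite invMg invgK mulKVg.
  by rewrite e invgK.
by rewrite sbmul_distr invMg invgK mulKVg.
Qed.

End SemiBraceLambda.

(** * The corner as a group under the semigroup product *)

(** A type of its own, since the corner carries two group laws and the subgroup
    type is already equipped with the law of B. *)
Definition corner_grp (B : finLeftSemiBraceType) : Type := {x : B | x \in corner B}.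

Section CornerGroup.
Variable B : finLeftSemiBraceType.
Implicit Types (p x y : B) (g h : corner_grp B).

HB.instance Definition _ := Finite.on (corner_grp B).

Lemma kappa_subproof x : 1 ** x ** 1 \in corner B.
Proof. by apply/imsetP; exists x. Qed.

Definition kappa x : corner_grp B := Sub (1 ** x ** 1) (kappa_subproof x).

Lemma kappaK : cancel val kappa.
Proof.
move=> g; apply: val_inj; rewrite /=.
by have /cornerP[-> ->] := valP g.
Qed.

Definition cgmul g h := kappa (val g ** val h).
Definition cginv g := odflt g [pick h | cgmul h g == kappa 1].

Lemma val_cgmul g h : val (cgmul g h) = val g ** val h.
Proof. by have /cornerP[e1 e2] := cornerM (valP g) (valP h); rewrite /= e1 e2. Qed.

Lemma val_kappa1 : val (kappa 1) = 1.
Proof. by rewrite /= !sbmul11. Qed.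

Lemma cgmulA : associative cgmul.
Proof. by move=> a b c; apply: val_inj; rewrite !val_cgmul sbmulA. Qed.

Lemma cgmul1 : left_id (kappa 1) cgmul.
Proof.
by move=> a; apply: val_inj; rewrite val_cgmul val_kappa1; have /cornerP[] := valP a.
Qed.

Lemma cgmulV : left_inverse (kappa 1) cginv cgmul.
Proof.
move=> g; rewrite /cginv; case: pickP => [h /eqP //|].
have [y yC yg] := corner_linv (valP g).
move=> /(_ (Sub y yC)) /eqP[]; apply: val_inj.
by rewrite val_cgmul val_kappa1.
Qed.

HB.instance Definition _ := Finite_isGroup.Build (corner_grp B)
  cgmulA cgmul1 cgmulV.

Lemma val_cornerM g h : val (g * h) = val g ** val h.
Proof. exact: val_cgmul. Qed.

Lemma val_corner1 : val (1 : corner_grp B) = 1.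
Proof. exact: val_kappa1. Qed.

Lemma kappa1 : kappa 1 = 1.
Proof. by []. Qed.

Lemma kappa_val g : kappa (val g) = g.
Proof. exact: kappaK. Qed.

Lemma val_kappa x : val (kappa x) = 1 ** x ** 1.
Proof. by []. Qed.

Lemma val_kappa_corner x : x \in corner B -> val (kappa x) = x.
Proof. by move=> xC; have /cornerP[e1 e2] := xC; rewrite val_kappa e1 e2. Qed.

(** [sb_lambda p] followed by the projection to the corner; unlike
    [sb_lambda p] itself it is an automorphism. *)
Definition lact p g := kappa (sb_lambda p (val g)).

Lemma val_lact p g : val (lact p g) = sb_lambda p (val g) ** 1.
Proof. by rewrite val_kappa sbmul1_lambda. Qed.

Lemma lact_kappa p x : lact p (kappa x) = kappa (sb_lambda p x).
Proof.
apply: val_inj; rewrite val_lact !val_kappa sb_lambda_morph sb_lambda_1mul.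
by rewrite -sbmulA sb_lambda_unit sbmul1_lambda.
Qed.

Lemma lactM p q g : lact (p * q) g = lact p (lact q g).
Proof. by rewrite [lact q g]/lact lact_kappa -sb_lambdaM. Qed.

Lemma lact1 g : lact 1 g = g.
Proof.
rewrite -[g]kappa_val lact_kappa sb_lambda1; apply: val_inj.
by rewrite !val_kappa !sbmulA sbmul11.
Qed.

Lemma lactK p : cancel (lact p) (lact p^-1).
Proof. by move=> g; rewrite -lactM mulVg lact1. Qed.

Lemma lactKV p : cancel (lact p^-1) (lact p).
Proof. by move=> g; rewrite -lactM mulgV lact1. Qed.

Lemma lact_morph p : {morph lact p : g h / g * h}.
Proof.
move=> g h; apply: val_inj; rewrite val_cornerM !val_lact val_cornerM.
by rewrite sb_lambda_morph -[RHS]sbmulA [1 ** (_ ** _)]sbmulA sbmul1_lambda sbmulA.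
Qed.

Lemma card_corner_grp : #|{: corner_grp B}| = #|corner B|.
Proof. exact: card_sig. Qed.

Hypothesis rhoB : rho_antihom B.

Lemma kappaM x y : kappa (x * y) = kappa x * lact x (kappa y).
Proof.
apply: val_inj; rewrite val_cornerM lact_kappa !val_kappa.
rewrite rho_antihom_cocycle // -[RHS]sbmulA [1 ** (_ ** _)]sbmulA.
by rewrite !sbmul1_lambda sbmulA.
Qed.

(** The solution depends on its arguments only through [kappa x] and the product
    [x * y] in the group. *)
Lemma sb_lambdaE x y : sb_lambda x y = val (kappa x)^-1 ** (x * y).
Proof.
have e : val (kappa x) ** sb_lambda x y = 1 ** (x * y).
  by rewrite val_kappa -sbmulA sbmul1_lambda rho_antihom_cocycle.
rewrite -[RHS]sbmul1m -e sbmulA -val_cornerM mulVg val_corner1.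
by rewrite sbmul1_lambda.
Qed.

Lemma sb_rE x y : sb_r B (x, y) = (sb_lambda x y, (sb_lambda x y)^-1 * (x * y)).
Proof.
by rewrite /sb_r /= /sb_rho /sb_lambda invMg !mulgA mulgKV.
Qed.

Lemma sb_r_eq x y x' y' : kappa x = kappa x' -> x * y = x' * y' ->
  sb_r B (x, y) = sb_r B (x', y').
Proof. by move=> ek em; rewrite !sb_rE !sb_lambdaE ek em. Qed.

End CornerGroup.

Arguments kappa : simpl never.
Arguments lact : simpl never.

(** * Words and their coordinates *)

Section Words.
Variable B : finLeftSemiBraceType.
Hypothesis rhoB : rho_antihom B.
Notation G := (corner_grp B).
Implicit Types (p x y : B) (w s t : seq B) (g h c : G) (a b : seq G).

Notation "s ~~> t" := (word_cong (sb_r B) s t) (at level 70).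

Definition wprod w : B := \prod_(x <- w) x.

Lemma wprod_cons x w : wprod (x :: w) = x * wprod w.
Proof. exact: big_cons. Qed.

Lemma wprod_cat s t : wprod (s ++ t) = wprod s * wprod t.
Proof. exact: big_cat. Qed.

Lemma wprod1 x : wprod [:: x] = x.
Proof. exact: big_seq1. Qed.

Lemma wprod_cong s t : s ~~> t -> wprod s = wprod t.
Proof.
elim=> // [x y u v|s1 s2 w _ -> _ -> //|s1 s2 t1 t2 _ e1 _ e2].
  by rewrite sb_rE => -[<- <-]; rewrite !wprod_cons !mulgA mulgV mul1g.
by rewrite !wprod_cat e1 e2.
Qed.

(** [p] stands for the product of the letters read so far. *)
Fixpoint coord p w : seq G :=
  if w is x :: t then lact p (kappa x) :: coord (p * x) t else [::].

Lemma size_coord p w : size (coord p w) = size w.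
Proof. by elim: w p => //= x w IH p; rewrite IH. Qed.

Lemma coord_cat p s t : coord p (s ++ t) = coord p s ++ coord (p * wprod s) t.
Proof.
elim: s p => [|x s IH] p /=; first by rewrite /wprod big_nil mulg1.
by rewrite IH wprod_cons mulgA.
Qed.

Lemma coord_lact p q w : coord (p * q) w = map (lact p) (coord q w).
Proof. by elim: w q => //= x w IH q; rewrite lactM -mulgA IH. Qed.

Lemma kappa_coord p w :
  kappa (p * wprod w) = kappa p * \prod_(g <- coord p w) g.
Proof.
elim: w p => [|x w IH] p; first by rewrite /wprod !big_nil !mulg1.
by rewrite wprod_cons mulgA IH big_cons kappaM // mulgA.
Qed.

Lemma coord_split p w a b : coord p w = a ++ b ->
  exists s t, [/\ w = s ++ t, coord p s = a & coord (p * wprod s) t = b].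
Proof.
move=> e; exists (take (size a) w), (drop (size a) w).
have sz : size (coord p (take (size a) w)) = size a.
  rewrite size_coord size_takel // -(size_coord p) e size_cat.
  exact: leq_addr.
move: e; rewrite -{1}(cat_take_drop (size a) w) coord_cat => /eqP.
by rewrite eqseq_cat // => /andP[/eqP-> /eqP->]; rewrite cat_take_drop.
Qed.

(** The key computation: in coordinates the solution is the conjugation rack.
    The first coordinate of the image is a direct consequence of the action law,
    and the second one is forced, as kappa turns the invariant group product
    into the product of the coordinates. *)
Lemma coord_r p x y u v : sb_r B (x, y) = (u, v) ->
  coord p [:: u; v] = [:: lact p (lact x (kappa y));
                         lact p (kappa x) ^ lact p (lact x (kappa y))].
Proof.
rewrite sb_rE => -[<- <-] /=; set u' := sb_lambda x y; set v' := _^-1 * _.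
have ku : kappa u' = lact x (kappa y) by rewrite lact_kappa.
have kv : kappa u' * lact u' (kappa v') = kappa x * kappa u'.
  by rewrite -kappaM // /v' mulKVg kappaM // ku.
rewrite -ku; congr [:: _; _]; rewrite lactM; apply: (mulgI (lact p (kappa u'))).
by rewrite conjgE mulKVg -!lact_morph kv.
Qed.

(** By [sb_r_eq] a pair of letters z, z' has the same image under the solution
    as the pair formed by [kappa z] and the letter that restores the product.
    Doing this from the left replaces all letters but the last by the elements
    of the corner that the coordinates prescribe, and the product then fixes
    the last letter. *)
Lemma coord_inj p w w' :
  coord p w = coord p w' -> wprod w = wprod w' -> w ~~> w'.
Proof.
elim: {w}(size w) {-2}w (erefl (size w)) p w' => [|n IH] w sw p w' ew ep.
  have /eqP := size_coord p w'; rewrite -ew size_coord sw eq_sym size_eq0.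
  by move: sw => /eqP; rewrite size_eq0 => /eqP-> /eqP->; apply: WCrefl.
case: w sw ew ep => // x [|y t] [sw]; case: w' => // x' [|y' t'] //=.
  by rewrite !wprod1 => _ ->; apply: WCrefl.
move=> /eqP; rewrite !eqseq_cons => /and3P[/eqP/(can_inj (lactK p)) kx /eqP e2 /eqP e3] ep.
(* the first letter may be replaced by its image in the corner *)
have pull z z' r : z :: z' :: r ~~>
    val (kappa z) :: ((val (kappa z))^-1 * (z * z')) :: r.
  rewrite -[z :: _]/([:: z; z'] ++ r) -[val _ :: _]/([:: _; _] ++ r).
  apply: WCcat (WCrefl _ _); set z0 := val _.
  case e : (sb_r B (z, z')) => [u v].
  apply: WCtrans (WCrel e) _; apply/WCsym/WCrel; rewrite -e.
  by apply: sb_r_eq; rewrite ?kappa_val ?mulKVg.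
apply: WCtrans (pull _ _ _) _; apply: WCtrans (WCsym (pull _ _ _)).
rewrite -cat1s -[X in _ ~~> X]cat1s -kx; apply: WCcat (WCrefl _ _) _.
set x0 := val (kappa x).
have step z z' r : kappa z = kappa x ->
    coord (p * x0) ((x0^-1 * (z * z')) :: r) = coord (p * z) (z' :: r).
  move=> kz /=; rewrite -!mulgA mulKVg; congr (_ :: _).
  rewrite !lactM; congr lact; apply: (mulgI (kappa x)).
  by rewrite -{1}[kappa x]kappa_val -kappaM // -/x0 mulKVg kappaM // kz.
apply: (IH (_ :: t) sw (p * x0)); first by rewrite !step //= e2 e3.
by move: ep; rewrite !wprod_cons -!mulgA => ->.
Qed.

(** The defining relations in coordinates, used from left to right only: the
    solution need not be invertible on B, so a step in coordinates lifts to
    words in this direction. *)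
Inductive cmove : seq G -> seq G -> Prop :=
| CMswap a b g h : cmove (a ++ g :: h :: b) (a ++ h :: g ^ h :: b)
| CMrefl a : cmove a a
| CMtrans a b a' : cmove a b -> cmove b a' -> cmove a a'.

Lemma cmove_lift w a b : cmove a b -> coord 1 w = a ->
  exists2 w', w ~~> w' & coord 1 w' = b.
Proof.
move=> ab; elim: ab w => {a b} [a b g h|a|a b a' _ IH1 _ IH2] w ew.
- have [s [t [-> es]]] := coord_split ew.
  case: t => [|x [|y t]] //= /eqP.
  rewrite !eqseq_cons => /and3P[/eqP eg /eqP eh /eqP et].
  case e : (sb_r B (x, y)) => [u v]; exists (s ++ u :: v :: t).
    apply: WCcat (WCrefl _ _) _; apply: (WCcat (s := [:: _; _]) (s' := [:: _; _])).
      exact: WCrel e.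
    exact: WCrefl.
  rewrite coord_cat es -[u :: v :: t]/([:: u; v] ++ t) coord_cat (coord_r _ e).
  rewrite -lactM eg eh -[b]et -(wprod_cong (WCrel e)) /=.
  by rewrite wprod_cons wprod1 !mulgA.
- by exists w => //; apply: WCrefl.
- have [w1 ww1 /IH2[w2 w12 ?]] := IH1 _ ew.
  by exists w2 => //; apply: WCtrans w12.
Qed.

Lemma cmove_cong w w' : cmove (coord 1 w) (coord 1 w') ->
  wprod w = wprod w' -> w ~~> w'.
Proof.
move=> /cmove_lift/(_ erefl) [w1 ww1 e] ep; apply: WCtrans (ww1) _.
by apply: coord_inj e _; rewrite -ep (wprod_cong ww1).
Qed.

Lemma cmove_catl a b b' : cmove b b' -> cmove (a ++ b) (a ++ b').
Proof.
elim=> [c d g h|c|c d e _ IH1 _ IH2]; last exact: CMtrans IH1 IH2.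
  by rewrite !catA; apply: CMswap.
exact: CMrefl.
Qed.

Lemma cmove_front a g b :
  cmove (a ++ g :: b) (g :: map (conjg^~ g) a ++ b).
Proof.
elim: a => [|h a IH] /=; first exact: CMrefl.
apply: CMtrans (cmove_catl [:: h] IH) _.
exact: (CMswap [::]).
Qed.

Lemma cmove_nseq n a g b :
  cmove (a ++ nseq n g ++ b) (nseq n g ++ map (conjg^~ (g ^+ n)) a ++ b).
Proof.
elim: n a => [|n IH] a /=.
  rewrite (eq_map (g := id)) ?map_id; first exact: CMrefl.
  by move=> h; rewrite /= conjg1.
apply: CMtrans (cmove_front _ _ _) _.
apply: CMtrans (cmove_catl [:: g] (IH _)) _; rewrite -map_comp /=.
rewrite (eq_map (g := conjg^~ (g ^+ n.+1))); first exact: CMrefl.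
by move=> h /=; rewrite -conjgM -expgS.
Qed.

(** Occurrences of g are moved to the front one by one from the left: moving
    one of them conjugates the letters before it by g, which preserves those
    that are equal to g. *)
Lemma cmove_count n a g : (n <= count_mem g a)%N ->
  exists b, cmove a (nseq n g ++ b).
Proof.
elim: n a => [|n IH] a; first by exists a; apply: CMrefl.
move=> na; have ga : g \in a by rewrite -has_pred1 has_count; apply: leq_trans na.
case/splitPr: ga na => a1 a2 na.
have [|b mb] := IH (map (conjg^~ g) a1 ++ a2).
  move: na; rewrite !count_cat /= eqxx add1n addnS ltnS => /leq_trans-> //.
  rewrite leq_add2r count_map; apply: sub_count => h /= /eqP->.
  by rewrite conjgE mulKg.
exists b; apply: CMtrans (cmove_front _ _ _) _.
exact: (cmove_catl [:: g]).
Qed.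

(** The letter of the corner whose coordinate after the prefix p is g. *)
Definition letter p g : B := val (lact p^-1 g).

Lemma lact_letter p g : lact p (kappa (letter p g)) = g.
Proof. by rewrite kappa_val lactKV. Qed.

Lemma letter_corner p g : letter p g \in corner B.
Proof. exact: (valP (lact _ _)). Qed.

Lemma letter_lact p x : x \in corner B -> letter p (lact p (kappa x)) = x.
Proof. by move=> xC; rewrite /letter lactK val_kappa_corner. Qed.

Fixpoint uncoord p a : seq B :=
  if a is g :: b then letter p g :: uncoord (p * letter p g) b else [::].

Lemma uncoordK p a : coord p (uncoord p a) = a.
Proof. by elim: a p => //= g a IH p; rewrite lact_letter IH. Qed.

Lemma uncoord_corner p a : all [in corner B] (uncoord p a).
Proof. by elim: a p => //= g a IH p; rewrite letter_corner IH. Qed.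

Lemma coordK p w : all [in corner B] w -> uncoord p (coord p w) = w.
Proof.
by elim: w p => //= x w IH p /andP[xC wC]; rewrite letter_lact // IH.
Qed.

Lemma wprod_corner w : all [in corner B] w -> wprod w \in corner B.
Proof.
move=> /allP wC; rewrite /wprod big_seq.
by apply: (@group_prod _ (corner_group B)) => x /wC.
Qed.

Lemma wprod_uncoord a : wprod (uncoord 1 a) = val (\prod_(g <- a) g).
Proof.
rewrite -{2}(uncoordK 1 a) -[\prod_(g <- _) g]mul1g -kappa1 -kappa_coord mul1g.
by rewrite val_kappa_corner // wprod_corner // uncoord_corner.
Qed.

(** The word of the normal element z_c: its coordinates are [#|C|] copies of
    c, so that conjugation by their product is trivial. *)
Definition cblock c : seq B := uncoord 1 (nseq #|{: G}| c).

Lemma expg_card_corner c : c ^+ #|{: G}| = 1.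
Proof. by rewrite -cardsT expg_cardG ?inE. Qed.

Lemma wprod_cblock c : wprod (cblock c) = 1.
Proof.
rewrite wprod_uncoord big_nseq -Monoid.iteropE -[X in val X]/(c ^+ #|{: G}|).
by rewrite expg_card_corner val_corner1.
Qed.

Lemma coord_cblock p c : coord p (cblock c) = nseq #|{: G}| (lact p c).
Proof. by rewrite -[p]mulg1 coord_lact uncoordK map_nseq mulg1. Qed.

(** After w the block for c has as coordinates the powers of [lact (wprod w) c];
    they move to the front without conjugating the coordinates of w. *)
Lemma cblock_normal w c :
  w ++ cblock c ~~> cblock (lact (wprod w) c) ++ w.
Proof.
apply: cmove_cong; last by rewrite !wprod_cat !wprod_cblock mulg1 mul1g.
rewrite !coord_cat wprod_cblock !mul1g !coord_cblock lact1.
have := cmove_nseq #|{: G}| (coord 1 w) (lact (wprod w) c) [::].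
rewrite !cats0 expg_card_corner (eq_map (g := id)) ?map_id //.
by move=> h; rewrite /= conjg1.
Qed.

Lemma size_cblock c : size (cblock c) = #|{: G}|.
Proof. by rewrite -(size_coord 1) coord_cblock size_nseq. Qed.

Lemma count_large a : (#|{: G}| * #|{: G}| < size a)%N ->
  exists c, (#|{: G}| <= count_mem c a)%N.
Proof.
move=> sa; apply/existsP; apply: contraLR sa; rewrite negb_exists => /forallP ca.
rewrite -leqNgt -count_predT.
have -> : count predT a = \sum_(c : G) count_mem c a.
  elim: a {ca} => [|g a IH] /=; first by rewrite big1.
  rewrite big_split /= -IH (bigD1 g) //= eqxx big1 // => h.
  by rewrite eq_sym => /negPf->.
rewrite -sum_nat_const; apply: leq_sum => c _.
by apply: ltnW; rewrite ltnNge.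
Qed.

Lemma cblock_extract w : (#|{: G}| * #|{: G}| < size w)%N ->
  exists c w', w ~~> cblock c ++ w'.
Proof.
move=> sw; have [c cc] : exists c, (#|{: G}| <= count_mem c (coord 1%g w))%N.
  by apply: count_large; rewrite size_coord.
have [b /cmove_lift/(_ erefl) [w1 ww1]] := cmove_count cc.
move=> /coord_split[s [t [es cs ct]]]; subst w1.
have szt : (0 < size t)%N.
  have := word_cong_size ww1; rewrite size_cat -(size_coord 1 s) cs size_nseq.
  move=> e; rewrite -(ltn_add2l #|{: G}|) addn0 -e; apply: leq_ltn_trans sw.
  by apply: leq_pmulr; apply/card_gt0P; exists c.
case: t szt ww1 ct => // x t _ ww1 ct.
have ks : kappa (wprod s) = 1.
  rewrite -[wprod s]mul1g kappa_coord cs kappa1 mul1g big_nseq.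
  by rewrite -Monoid.iteropE -[LHS]/(c ^+ #|{: G}|) expg_card_corner.
(* the prefix s need not have product 1, only [kappa] of it is trivial; the
   defect is pushed into the next letter *)
exists c, (wprod s * x :: t); apply: WCtrans (ww1) _. apply: (coord_inj (p := 1)).
  rewrite !coord_cat coord_cblock lact1 cs wprod_cblock !mul1g /= mul1g; congr (_ ++ _ :: _).
  by rewrite lact1 kappaM // ks mul1g.
by rewrite !wprod_cat wprod_cblock mul1g !wprod_cons mulgA.
Qed.

(** The last letter cannot be taken in the corner, since the product of the word
    is an arbitrary element of B. *)
Lemma last_letter w : w != [::] ->
  exists a z, w ~~> uncoord 1 a ++ [:: z].
Proof.
case: (lastP w) => // w' x _.
exists (coord 1 w'); set v := uncoord 1 _.
exists ((wprod v)^-1 * wprod (rcons w' x)); apply: (coord_inj (p := 1)).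
  rewrite -cats1 !coord_cat uncoordK !mul1g; congr (_ ++ [:: _]).
  have kv : kappa (wprod v) = kappa (wprod w').
    by rewrite -[wprod v]mul1g -[wprod w']mul1g !kappa_coord uncoordK.
  apply: (mulgI (kappa (wprod v))); rewrite -[RHS]kappaM // mulKVg.
  by rewrite wprod_cat wprod1 kappaM // kv.
by rewrite wprod_cat wprod1 mulKVg.
Qed.

End Words.

(** * Comparison with the structure monoid of the corner *)

Section CornerTransport.
Variable B : finLeftSemiBraceType.
Hypothesis rhoB : rho_antihom B.
Notation G := (corner_grp B).
Notation D := (corner_sb B).
Implicit Types (p q x y : B) (w s t : seq B).

Definition in_corner x : D := subg (corner_group B) x.
Definition of_corner (x : D) : B := sgval x.

Lemma of_cornerK : cancel of_corner in_corner.
Proof. exact: sgvalK. Qed.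

Lemma in_cornerK x : x \in corner B -> of_corner (in_corner x) = x.
Proof. exact: subgK. Qed.

Lemma of_corner_in (x : D) : of_corner x \in corner B.
Proof. exact: subgP. Qed.

Lemma of_corner_map_in w : all [in corner B] w -> map of_corner (map in_corner w) = w.
Proof. by elim: w => //= x w IH /andP[xC /IH->]; rewrite in_cornerK. Qed.

Lemma of_corner_r (x y : D) :
  sb_r B (of_corner x, of_corner y) =
    (of_corner (sb_r D (x, y)).1, of_corner (sb_r D (x, y)).2).
Proof.
have ml (a b : D) : of_corner (a ** b) = of_corner a ** of_corner b.
  exact: val_corner_sbmul.
have mm (a b : D) : of_corner (a * b) = of_corner a * of_corner b by [].
have mv (a : D) : of_corner a^-1 = (of_corner a)^-1 by [].
rewrite /sb_r /sb_rho /sb_lambda ![(_, _).1]/= ![(_, _).2]/=.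
by rewrite !(mm, mv, ml).
Qed.

Lemma of_corner_cong (s t : seq D) : word_cong (sb_r D) s t ->
  word_cong (sb_r B) (map of_corner s) (map of_corner t).
Proof.
elim=> [x y u v e|{}s|{}s {}t _|s1 s2 w _ IH1 _ IH2|s1 s2 t1 t2 _ IH1 _ IH2].
- by apply: WCrel; rewrite of_corner_r e.
- exact: WCrefl.
- exact: WCsym.
- exact: WCtrans IH1 IH2.
- by rewrite !map_cat; apply: WCcat.
Qed.

Lemma uncoord_cat p (a b : seq G) :
  uncoord p (a ++ b) = uncoord p a ++ uncoord (p * wprod (uncoord p a)) b.
Proof.
elim: a p => [|g a IH] p /=; first by rewrite /wprod big_nil mulg1.
by rewrite IH wprod_cons mulgA.
Qed.

Lemma corner_eq x y : x \in corner B -> y \in corner B ->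
  kappa x = kappa y -> x = y.
Proof.
by move=> xC yC e; rewrite -[x]val_kappa_corner // e val_kappa_corner.
Qed.

(** Reading the coordinates of a word of B as those of a word of the corner.
    The map is not a morphism, as the prefix acts on the coordinates; the
    induction on the congruence goes through because the prefixes p in B and q
    in the corner are arbitrary. *)
Lemma transport p q s t : q \in corner B -> word_cong (sb_r B) s t ->
  word_cong (sb_r D) (map in_corner (uncoord q (coord p s)))
                     (map in_corner (uncoord q (coord p t))).
Proof.
move=> qC st; elim: st p q qC =>
  [x y u v e|{}s|{}s {}t _ IH|s1 s2 w _ IH1 _ IH2|s1 s2 t1 t2 s12 IH1 _ IH2] p q qC.
- rewrite (coord_r rhoB p e) /=; set g := lact p (kappa x).
  have -> : lact (p * x) (kappa y) = lact p (lact x (kappa y)) by rewrite lactM.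
  set h := lact p _.
  set x1 := letter q g; set u1 := letter q h; set y1 := letter _ h.
  set v1 := letter _ (g ^ h).
  have [x1C u1C y1C v1C] :
    [/\ x1 \in corner B, u1 \in corner B, y1 \in corner B & v1 \in corner B].
    by split; apply: letter_corner.
  have kx : lact q (kappa x1) = g by apply: lact_letter.
  have ku : lact q (kappa u1) = h by apply: lact_letter.
  have ky : lact (q * x1) (kappa y1) = h by apply: lact_letter.
  have kv : lact (q * u1) (kappa v1) = g ^ h by apply: lact_letter.
  have e1 : x1 * y1 = u1 * v1.
    apply: corner_eq; try by apply: (@groupM _ (corner_group B)).
    rewrite !kappaM //; apply: (can_inj (lactK q)).
    by rewrite !lact_morph -!lactM kx ku ky kv conjgE mulKVg.
  have e2 : sb_lambda x1 y1 = u1.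
    apply: corner_eq => //.
      apply: (@groupM _ (corner_group B)) => //; apply: cornerM => //.
      by apply: (@groupVr _ (corner_group B)).
    by apply: (can_inj (lactK q)); rewrite -lact_kappa -lactM ky ku.
  apply: WCrel; have := of_corner_r (in_corner x1) (in_corner y1).
  rewrite !in_cornerK // sb_rE e2 e1 mulKg => e3.
  have -> : u1 = of_corner (sb_r D (in_corner x1, in_corner y1)).1.
    by move: (congr1 fst e3).
  have -> : v1 = of_corner (sb_r D (in_corner x1, in_corner y1)).2.
    by move: (congr1 snd e3).
  by rewrite !of_cornerK -surjective_pairing.
- exact: WCrefl.
- by apply: WCsym; apply: IH.
- exact: WCtrans (IH1 _ _ qC) (IH2 _ _ qC).
rewrite !coord_cat !uncoord_cat !map_cat -(wprod_cong s12).
have := wprod_cong (of_corner_cong (IH1 p q qC)).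
rewrite !of_corner_map_in ?uncoord_corner // => <-.
apply: WCcat; first exact: IH1.
apply: IH2; apply: (@groupM _ (corner_group B)) => //.
by rewrite wprod_corner // uncoord_corner.
Qed.

Lemma of_corner_inj (s t : seq D) :
  word_cong (sb_r B) (map of_corner s) (map of_corner t) -> word_cong (sb_r D) s t.
Proof.
have aC (w : seq D) : all [in corner B] (map of_corner w).
  by apply/allP => _ /mapP[x _ ->]; apply: of_corner_in.
have mK (w : seq D) : map in_corner (map of_corner w) = w.
  by rewrite -map_comp map_id_in // => x _; apply: of_cornerK.
move=> /(@transport 1 1 _ _ (@group1 _ (corner_group B))).
by rewrite !coordK // !mK.
Qed.

(** Conjugation in the corner is trivial in this case. *)
Lemma coord_perm p s t : commutative (@sbmul B) -> word_cong (sb_r B) s t ->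
  perm_eq (coord p s) (coord p t).
Proof.
move=> mC st; elim: st p =>
  [x y u v e|{}s|{}s {}t _ IH|s1 s2 w _ IH1 _ IH2|s1 s2 t1 t2 s12 IH1 _ IH2] p //.
- have cC : forall g h : G, g ^ h = g.
    move=> g h; rewrite conjgE (_ : g * h = h * g) ?mulKg //.
    by apply: val_inj; rewrite !val_cornerM mC.
  by rewrite (coord_r rhoB p e) cC /= lactM (perm_catC [:: _] [:: _]).
- by rewrite perm_sym.
- exact: perm_trans (IH1 p) (IH2 p).
by rewrite !coord_cat -(wprod_cong s12) perm_cat.
Qed.

End CornerTransport.

Local Close Scope group_scope.
Local Open Scope ring_scope.
Local Open Scope classical_set_scope.

(** * Hilbert's basis theorem for modules over commuting operators *)

Section HilbertBasis.
Variables (K : fieldType) (V : lmodType K) (I : finType) (T : I -> V -> V).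
Hypothesis Tlin : forall i (c : K) x y, T i (c *: x + y) = c *: T i x + T i y.
Hypothesis Tcomm : forall i j x, T i (T j x) = T j (T i x).
Implicit Types (U W : set V) (js : seq I).

Definition stable_sub js U : Prop :=
  [/\ U 0, forall (c : K) x y, U x -> U y -> U (c *: x + y) &
      forall i x, i \in js -> U x -> U (T i x)].

(** The ascending chain condition for the subspaces of U that are stable under
    the operators with index in js. *)
Definition noeth_on js U : Prop := forall J : nat -> set V,
  (forall n, stable_sub js (J n)) -> (forall n, J n `<=` U) ->
  (forall n, J n `<=` J n.+1) ->
  exists N, forall n, (N <= n)%N -> J n `<=` J N.

Lemma chain_le (J : nat -> set V) : (forall n, J n `<=` J n.+1) ->
  forall m n, (m <= n)%N -> J m `<=` J n.
Proof.
move=> Jle m n /subnK<-; elim: (n - m)%N => // k IH x /IH; rewrite addSn.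
exact: Jle.
Qed.

Lemma T0 i : T i 0 = 0.
Proof.
have := Tlin i 1 0 0; rewrite scaler0 scale1r addr0 => e.
by apply: (addrI (T i 0)); rewrite addr0 -e.
Qed.

Lemma TD i x y : T i (x + y) = T i x + T i y.
Proof. by have := Tlin i 1 x y; rewrite !scale1r. Qed.

Lemma noeth_on0 : noeth_on [::] [set 0].
Proof.
move=> J sJ J0 _; exists 0%N => n _ x /J0 ->; by case: (sJ 0%N).
Qed.

Definition add_line U v : set V := [set x | exists u (c : K), U u /\ x = u + c *: v].

Lemma stable_add_line U v : stable_sub [::] U -> stable_sub [::] (add_line U v).
Proof.
move=> [U0 UD _]; split=> //; first by exists 0, 0; rewrite scale0r addr0.
move=> c _ _ [u [a [Uu ->]]] [u' [a' [Uu' ->]]].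
exists (c *: u + u'), (c * a + a'); split; first exact: UD.
by rewrite scalerDr scalerA addrACA scalerDl.
Qed.

(** A chain is controlled by its traces on U once it contains a vector with a
    nonzero component along v, and it stays inside U if it never does. *)
Lemma noeth_add_line U v : stable_sub [::] U -> noeth_on [::] U ->
  noeth_on [::] (add_line U v).
Proof.
move=> [U0 UD _] nU J sJ JU Jle.
have subJU n : stable_sub [::] (J n `&` U).
  have [J0 JD _] := sJ n; split=> // c x y [Jx Ux] [Jy Uy].
  by split; [apply: JD|apply: UD].
have [|n x [/Jle] //|N HN] := nU (fun n => J n `&` U) subJU.
  by move=> n x [].
have Jm := chain_le Jle.
have [[n0 [u0 [Uu0 Ju0]]]|nex] := pselect (exists n u, U u /\ J n (u + v)).
  exists (maxn N n0) => n; rewrite geq_max => /andP[Nn n0n] x Jx.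
  have [u [c [Uu ex]]] := JU _ _ Jx.
  have Jv k : (n0 <= k)%N -> J k (u0 + v) by move=> /Jm; apply.
  have [_ JDn _] := sJ n; have [_ JDN _] := sJ (maxn N n0).
  have ey : x = c *: (u0 + v) + (- c *: (u0 + v) + x).
    by rewrite addrA -scalerDl subrr scale0r add0r.
  rewrite ey; apply: JDN; first by apply: Jv; rewrite leq_maxr.
  apply: (Jm N); first by rewrite leq_maxl.
  apply: proj1 (HN n Nn _ _); split; first by apply: JDn => //; apply: Jv.
  rewrite ex scalerDr addrACA [_ *: v + _]addrC [- c *: v]scaleNr subrr addr0.
  exact: UD.
exists N => n Nn x Jx; apply: proj1 (HN n Nn x _); split=> //.
have [u [c [Uu ex]]] := JU _ _ Jx; rewrite ex.
have [->|c0] := eqVneq c 0; first by rewrite scale0r addr0.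
case: nex; exists n, (c^-1 *: u + 0); split; first exact: UD.
have [J0 JD _] := sJ n.
have -> : c^-1 *: u + 0 + v = c^-1 *: x + 0.
  by rewrite ex scalerDr scalerA mulVf // scale1r !addr0.
exact: JD.
Qed.

Section Step.
Variables (i : I) (js : seq I) (U : set V).
Hypotheses (sU : stable_sub js U) (nU : noeth_on js U).

(** The values of the polynomials of degree less than n in [T i] with
    coefficients in U; such a presentation of a vector is in general not
    unique. *)
Fixpoint polys n : set V :=
  if n is m.+1 then
    [set x | exists u y, [/\ U u, polys m y & x = iter m (T i) u + y]]
  else [set 0].

Lemma iter_lin n (c : K) x y :
  iter n (T i) (c *: x + y) = c *: iter n (T i) x + iter n (T i) y.
Proof. by elim: n => //= n ->; rewrite Tlin. Qed.

Lemma iter_comm n j x : T j (iter n (T i) x) = iter n (T i) (T j x).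
Proof. by elim: n => //= n <-; rewrite Tcomm. Qed.

Lemma stable_polys n : stable_sub js (polys n).
Proof.
have [U0 UD UT] := sU.
elim: n => [|n [P0 PD PT]] /=.
  split=> // [c x y -> ->|j x _ ->]; first by rewrite scaler0 addr0.
  by rewrite /= T0.
split=> [|c _ _ [u [y [Uu Py ->]]] [u' [y' [Uu' Py' ->]]]|j _ jj [u [y [Uu Py ->]]]].
- exists 0, 0; split=> //; rewrite addr0; elim: (n) => //= m <-; by rewrite T0.
- exists (c *: u + u'), (c *: y + y'); split; [exact: UD|exact: PD|].
  by rewrite iter_lin scalerDr addrACA.
- exists (T j u), (T j y); split; [exact: UT|exact: PT|].
  by rewrite TD iter_comm.
Qed.

Lemma polysS n : polys n `<=` polys n.+1.
Proof.
move=> x Px; exists 0, x; split=> //; first by case: sU.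
rewrite (_ : iter n _ 0 = 0) ?add0r //; elim: (n) => //= m ->; by rewrite T0.
Qed.

Lemma polysT n x : polys n x -> polys n.+1 (T i x).
Proof.
elim: n x => [x -> |n IH _ [u [y [Uu Py ->]]]].
  by rewrite T0; apply: polysS.
exists u, (T i y); split; [by []|exact: IH|by rewrite TD].
Qed.

Definition all_polys : set V := [set x | exists n, polys n x].

Lemma polys_le m n : (m <= n)%N -> polys m `<=` polys n.
Proof. exact: (chain_le polysS). Qed.

Lemma sub_all_polys : U `<=` all_polys.
Proof. by move=> u Uu; exists 1%N; exists u, 0; rewrite addr0. Qed.

Lemma stable_all_polys : stable_sub (i :: js) all_polys.
Proof.
split; first by exists 0%N.
  move=> c x y [m Pm] [n Pn]; exists (maxn m n).
  have [_ PD _] := stable_polys (maxn m n).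
  by apply: PD; [apply: (polys_le (leq_maxl m n))|apply: (polys_le (leq_maxr m n))].
move=> j x; rewrite inE => /orP[/eqP->|jj] [n Pn].
  by exists n.+1; apply: polysT.
by exists n; have [_ _ PT] := stable_polys n; apply: PT.
Qed.

(** The leading coefficients of the elements of W presented with degree n. *)
Definition lead n W : set V :=
  [set u | U u /\ exists2 y, polys n y & W (iter n (T i) u + y)].

Lemma stable_lead n W : stable_sub (i :: js) W -> stable_sub js (lead n W).
Proof.
have [U0 UD UT] := sU; move=> [W0 WD WT].
have [P0 PD PT] := stable_polys n.
split=> [|c u u' [Uu [y Py Wy]] [Uu' [y' Py' Wy']]|j u jj [Uu [y Py Wy]]].
- split=> //; exists 0 => //; rewrite addr0 (_ : iter n _ 0 = 0) //.
  by elim: (n) => //= m ->; rewrite T0.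
- split; first exact: UD.
  exists (c *: y + y'); first exact: PD.
  by rewrite iter_lin addrACA -scalerDr; apply: WD.
- split; first exact: UT.
  exists (T j y); first exact: PT.
  by rewrite -iter_comm -TD; apply: WT; rewrite // inE jj orbT.
Qed.

Lemma leadS n W : stable_sub (i :: js) W -> lead n W `<=` lead n.+1 W.
Proof.
move=> [_ _ WT] u [Uu [y Py Wy]]; split=> //; exists (T i y); first exact: polysT.
by rewrite /= -TD; apply: WT; rewrite // mem_head.
Qed.

Lemma leadW n W W' : W `<=` W' -> lead n W `<=` lead n W'.
Proof. by move=> WW' u [Uu [y Py Wy]]; split=> //; exists y => //; apply: WW'. Qed.

(** Hilbert's argument: subtract an element of W with the same leading
    coefficient and descend on the degree. *)
Lemma lead_sub W W' : stable_sub (i :: js) W -> stable_sub (i :: js) W' ->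
  W `<=` W' -> W' `<=` all_polys -> (forall n, lead n W' `<=` lead n W) ->
  W' `<=` W.
Proof.
move=> [W0 WD _] [_ WD' _] WW' WP' ld x Wx; have [n Pn] := WP' _ Wx.
elim: n x Wx Pn => [x _ -> //|n IH x Wx [u [y [Uu Py ex]]]].
have [|_ [y' Py' Wy']] := ld n u; first by split=> //; exists y; rewrite -?ex.
have -> : x = 1 *: (iter n (T i) u + y') + (- 1 *: y' + y).
  by rewrite ex scale1r scaleN1r -addrA (addrA y') subrr add0r.
apply: WD => //; apply: IH; last by have [_ PD _] := stable_polys n; apply: PD.
have -> : - 1 *: y' + y = - 1 *: (iter n (T i) u + y') + x.
  by rewrite ex !scaleN1r opprD addrACA addNr add0r.
by apply: WD' => //; apply: WW'.
Qed.

(** The leading coefficients of degree n of the m-th subspace grow with n and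
    with m.  The diagonal sequence stabilizes at some N0, which settles all
    degrees from N0 on; each of the finitely many smaller degrees stabilizes by
    itself. *)
Lemma noeth_all_polys : noeth_on (i :: js) all_polys.
Proof.
move=> J sJ JP Jle; have Jm := chain_le Jle.
have lle n m n' m' : (n <= n')%N -> (m <= m')%N -> lead n (J m) `<=` lead n' (J m').
  move=> nn mm x /(leadW (Jm _ _ mm)); exact: (chain_le (fun k => leadS (n := k) (sJ m'))).
have [|||N0 HN0] := nU (J := fun m => lead m (J m)).
- by move=> n; apply: stable_lead.
- by move=> n x [].
- by move=> n; apply: lle.
have [f Hf] : {f : nat -> nat & forall n m, (f n <= m)%N ->
    lead n (J m) `<=` lead n (J (f n))}.
  apply: (@choice _ _ (fun n N => forall m, (N <= m)%N ->
     lead n (J m) `<=` lead n (J N))) => n.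
  apply: (nU (J := fun m => lead n (J m))) => [m|m x []|m] //.
    exact: stable_lead.
  exact: lle.
set N := maxn N0 (\max_(n < N0) f n); exists N => m Nm.
apply: lead_sub => //; [exact: Jm|move=> n].
have [nN|Nn] := ltnP n N0.
  move=> x Lx; have fN : (f n <= N)%N.
    apply: leq_trans (leq_maxr _ _).
    exact: (@leq_bigmax _ (fun k : 'I_N0 => f k) (Ordinal nN)).
  apply: (lle n (f n)) => //; apply: Hf Lx; exact: leq_trans Nm.
move=> x Lx; apply: (lle N0 N0) => //; first exact: leq_maxl.
apply: (HN0 (maxn n m)); first by apply: leq_trans Nn _; apply: leq_maxl.
by apply: lle Lx; [apply: leq_maxl|apply: leq_maxr].
Qed.

End Step.

Lemma noeth_span (vs : seq V) : exists U, [/\ stable_sub [::] U,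
  {in vs, forall v, U v} & noeth_on [::] U].
Proof.
elim: vs => [|v vs [U [sU Uvs nU]]].
  exists [set 0]; split=> //; last exact: noeth_on0.
  by split=> // c x y -> ->; rewrite scaler0 addr0.
exists (add_line U v); split; [exact: stable_add_line| |exact: noeth_add_line].
move=> x; rewrite inE => /orP[/eqP->|/Uvs Ux].
  by exists 0, 1; split; [case: sU|rewrite scale1r add0r].
by exists x, 0; rewrite scale0r addr0.
Qed.

(** A space that is generated by finitely many vectors under finitely many
    commuting operators is Noetherian: start with the span of the vectors and
    adjoin the operators one at a time. *)
Theorem noeth_generated (vs : seq V) :
  (forall W, stable_sub (enum I) W -> {in vs, forall v, W v} -> W = setT) ->
  noeth_on (enum I) setT.
Proof.
move=> gen.
have [U [sU Uvs nU]] : exists U, [/\ stable_sub (enum I) U,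
    {in vs, forall v, U v} & noeth_on (enum I) U].
  elim: (enum I) => [|i js [U [sU Uvs nU]]]; first exact: noeth_span.
  exists (all_polys i U); split; [exact: stable_all_polys| |exact: noeth_all_polys].
  by move=> v /Uvs; apply: sub_all_polys.
by rewrite -(gen U).
Qed.

End HilbertBasis.

(** * Monoid algebras of finite type over normal elements *)

Section MonomialBasis.
Variables (K : fieldType) (M : monomType).
Notation A := (monoid_algebra K M).

Definition mon (m : M) : A := mkmalgU m (1 : K).

Lemma monM m m' : mon (mmul m m') = mon m * mon m'.
Proof. by rewrite [RHS]malgM_def fgmulUU mulr1. Qed.

Lemma mon1 : mon mone = 1.
Proof. by []. Qed.

Lemma mon_prod (J : Type) (r : seq J) (f : J -> M) :
  \prod_(j <- r) mon (f j) = mon (\big[mmul/mone]_(j <- r) f j).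
Proof. by rewrite (big_morph mon monM mon1). Qed.

Lemma monE (x : A) : x = \sum_(m <- msupp x) mcoeff m x *: mon m.
Proof.
rewrite {1}[x]monalgE; apply: eq_bigr => m _; apply/malgP => m'.
by rewrite mcoeffZ !mcoeffU mulrnAr mulr1.
Qed.

Lemma mcoeff_mon m m' : mcoeff m' (mon m) = (m == m')%:R.
Proof. exact: mcoeffU1. Qed.

End MonomialBasis.
Arguments mon K {M} m.

(** For m = (c + 2) ^ 2 one has (2 m)! >= m ^ m * m! > m ^ m = (c + 2) ^ (2 m). *)
Lemma fact_gt_exp c : exists n, (c ^ n < n`!)%N.
Proof.
have fact_ge m i : (m ^ i * m`! <= (m + i)`!)%N.
  elim: i => [|i IH]; first by rewrite mul1n addn0.
  rewrite addnS factS expnS -mulnA; apply: leq_mul => //.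
  by rewrite -addnS leq_addr.
set m := (c.+2 ^ 2)%N; exists (m + m)%N.
apply: (@leq_ltn_trans (c.+2 ^ (m + m))).
  have : (0 < m + m)%N by rewrite addn_gt0 expn_gt0.
  by move=> mm; rewrite leq_exp2r // -addn2 leq_addr.
rewrite addnn -mul2n expnM -/m mul2n -addnn; apply: leq_trans (fact_ge m m).
have m2 : (1 < m)%N by rewrite /m -(exp1n 2) ltn_exp2r.
rewrite -[X in (X < _)%N]muln1 ltn_pmul2l; last by rewrite expn_gt0 (ltnW m2).
exact: leq_trans m2 (fact_geq _).
Qed.

(** The z i are normal elements, with M permuting them by s, and F generates M
    over them.  The third condition makes the z i commute.  The last
    condition is the corresponding induction principle, and it only multiplies
    on the left; multiplication on the right is equivalent because the s m are
    permutations. *)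
Definition normal_gen (M : monomType) (I : finType) (z : I -> M)
    (s : M -> I -> I) (F : seq M) : Prop :=
  [/\ forall m i, mmul m (z i) = mmul (z (s m i)) m,
      forall m, injective (s m),
      forall i j, s (z i) j = j &
      forall P : M -> Prop, (forall m, m \in F -> P m) ->
        (forall i m, P m -> P (mmul (z i) m)) -> forall m, P m].

Section NormalGen.
Variables (K : fieldType) (M : monomType) (I : finType).
Variables (z : I -> M) (s : M -> I -> I) (F : seq M).
Hypothesis ng : normal_gen z s F.
Notation A := (monoid_algebra K M).

Let znorm m i : mmul m (z i) = mmul (z (s m i)) m.
Proof. by case: ng. Qed.

Let zcomm i j : mmul (z i) (z j) = mmul (z j) (z i).
Proof. by case: ng => _ _ zs _; rewrite znorm zs. Qed.

Let sub_all (js := enum I) (T : I -> A -> A) W :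
  stable_sub T js W -> (forall m, W (mon K m)) -> W = setT.
Proof.
move=> [W0 WD _] Wm; apply/seteqP; split=> // x _; rewrite [x]monE.
elim: (enum_fset _) => [|m r IH]; first by rewrite big_nil.
by rewrite big_cons; apply: WD.
Qed.

Lemma normal_gen_left_noetherian : left_noetherian A.
Proof.
pose T i (x : A) : A := mon K (z i) * x.
have [_ _ _ gen] := ng.
have nt : noeth_on T (enum I) setT.
  apply: (@noeth_generated K A I T _ _ (map (mon K) F)).
  - by move=> i c x y; rewrite /T mulrDr scalerAr.
  - by move=> i j x; rewrite /T !mulrA -!monM zcomm.
  move=> W sW Wv; apply: (sub_all sW); apply: gen => [m mF|i m Wm].
    by apply: Wv; apply: map_f.
  by rewrite monM; have [_ _ WT] := sW; apply: (WT i) => //; rewrite mem_enum.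
move=> J lJ Jle; have [|||N HN] := nt J.
- move=> n; have [J0 JB JM] := lJ n.
  have JZ (c : K) x : J n x -> J n (c *: x).
    by move=> Jx; rewrite -[x]mul1r scalerAl; apply: JM.
  split=> // [c x y Jx Jy|i x _ Jx]; last exact: JM.
  rewrite -[y]opprK; apply: JB; first exact: JZ.
  by rewrite -scaleN1r; apply: JZ.
- by [].
- exact: Jle.
exists N => n Nn; apply/seteqP; split; first exact: HN.
exact: (chain_le Jle).
Qed.

Lemma normal_gen_right_noetherian : right_noetherian A.
Proof.
pose T i (x : A) : A := x * mon K (z i).
have [_ sinj _ gen] := ng.
have nt : noeth_on T (enum I) setT.
  apply: (@noeth_generated K A I T _ _ (map (mon K) F)).
  - by move=> i c x y; rewrite /T mulrDl scalerAl.
  - by move=> i j x; rewrite /T -!mulrA -!monM zcomm.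
  move=> W sW Wv; apply: (sub_all sW); apply: gen => [m mF|i m Wm].
    by apply: Wv; apply: map_f.
  have [j ji] : exists j, s m j = i.
    by exists (invF (@sinj m) i); rewrite f_invF.
  rewrite -ji -znorm monM; have [_ _ WT] := sW.
  by apply: (WT j) => //; rewrite mem_enum.
move=> J lJ Jle; have [|||N HN] := nt J.
- move=> n; have [J0 JB JM] := lJ n.
  have JZ (c : K) x : J n x -> J n (c *: x).
    by move=> Jx; rewrite -[x]mulr1 scalerAr; apply: JM.
  split=> // [c x y Jx Jy|i x _ Jx]; last exact: JM.
  rewrite -[y]opprK; apply: JB; first exact: JZ.
  by rewrite -scaleN1r; apply: JZ.
- by [].
- exact: Jle.
exists N => n Nn; apply/seteqP; split; first exact: HN.
exact: (chain_le Jle).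
Qed.

Notation mprod := (fun r f => \big[mmul/mone]_(j <- r) f j).

Definition zeta (l : seq I) : M := \big[mmul/mone]_(i <- l) z i.

Lemma zeta_cat l l' : zeta (l ++ l') = mmul (zeta l) (zeta l').
Proof. exact: big_cat. Qed.

Lemma zeta_cons i l : zeta (i :: l) = mmul (z i) (zeta l).
Proof. exact: big_cons. Qed.

Lemma zeta_comm i l : mmul (zeta l) (z i) = mmul (z i) (zeta l).
Proof.
elim: l => [|j l IH]; first by rewrite /zeta big_nil mulm1 mul1m.
by rewrite zeta_cons -mulmA IH mulmA zcomm mulmA.
Qed.

(** The submonoid generated by the z i is commutative, although M is not. *)
Lemma zeta_perm l l' : perm_eq l l' -> zeta l = zeta l'.
Proof.
elim: l' l => [|i l' IH] l; first by move=> /perm_nilP->.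
move=> p; have := perm_mem p i; rewrite mem_head => il.
case/splitPr: il p => l1 l2 p; have {}p : perm_eq (l1 ++ l2) l'.
  by rewrite -(perm_cons i) -[i :: _ ++ _]/([:: i] ++ l1 ++ l2) perm_catCA.
by rewrite zeta_cat !zeta_cons -(IH _ p) zeta_cat mulmA zeta_comm mulmA.
Qed.

Lemma zeta_norm m l : mmul m (zeta l) = mmul (zeta (map (s m) l)) m.
Proof.
rewrite /zeta; elim: l => [|i l IH]; first by rewrite !big_nil mulm1 mul1m.
by rewrite /= !big_cons mulmA znorm -mulmA IH mulmA.
Qed.

Lemma normal_form m : exists l f, f \in F /\ m = mmul (zeta l) f.
Proof.
have [_ _ _ gen] := ng.
pose P m := exists l f, f \in F /\ m = mmul (zeta l) f.
apply: (gen P) => [{}m mF|i {}m [l [f [fF ->]]]].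
  by exists [::], m; rewrite /zeta big_nil mul1m.
by exists (i :: l), f; rewrite /zeta big_cons mulmA.
Qed.

Section NormalProduct.
Variables (J : eqType) (l : J -> seq I) (f : J -> M).

(** How the normal elements of the factor j are permuted when they are moved
    across the factors that precede it. *)
Definition twist (js : seq J) (j : J) : I -> I :=
  s (\big[mmul/mone]_(k <- take (index j js) js) f k).

Lemma prod_normal_form js : uniq js ->
  \big[mmul/mone]_(j <- js) mmul (zeta (l j)) (f j) =
  mmul (zeta (flatten [seq map (twist js j) (l j) | j <- js]))
       (\big[mmul/mone]_(j <- js) f j).
Proof.
move=> ujs; rewrite -[LHS]mul1m.
have gen pre r : uniq (pre ++ r) ->
  mmul (\big[mmul/mone]_(k <- pre) f k)
       (\big[mmul/mone]_(j <- r) mmul (zeta (l j)) (f j)) =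
  mmul (zeta (flatten [seq map (twist (pre ++ r) j) (l j) | j <- r]))
       (\big[mmul/mone]_(j <- pre ++ r) f j).
  elim: r pre => [|j r IH] pre upr.
    by rewrite /= cats0 /zeta !big_nil mulm1 mul1m.
  rewrite big_cons /= mulmA mulmA zeta_norm -!mulmA.
  have := IH (rcons pre j); rewrite cat_rcons => /(_ upr).
  rewrite big_rcons /= -mulmA => ->.
  rewrite zeta_cat -mulmA; congr (mmul (zeta (map _ _)) _).
  rewrite /twist; move: upr; rewrite cat_uniq /= => /and3P[_ /norP[jp _] _].
  by rewrite index_cat (negPf jp) /= eqxx addn0 take_size_cat.
by have := gen [::] js ujs; rewrite big_nil.
Qed.
End NormalProduct.

Section Multilinear.
Variables (n : nat) (al : 'S_n -> K).

Definition perm_seq (sg : 'S_n) : seq 'I_n := [seq sg j | j <- index_enum 'I_n].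

Definition multilinear_poly : {malg K[{fmonom 'I_n}]} :=
  \sum_sg mkmalgU (FMonom (perm_seq sg)) (al sg).

Lemma multilinear_poly_neq0 sg : al sg != 0 -> multilinear_poly != 0.
Proof.
apply: contraNneq => /(congr1 (mcoeff (FMonom (perm_seq sg)))).
rewrite mcoeff0 raddf_sum /= (bigD1 sg) //= mcoeffU eqxx mulr1n big1 ?addr0 => [->//|].
move=> sg' ne; rewrite mcoeffU (_ : _ == _ = false) ?mulr0n //.
apply: contraNF ne => /eqP[/eq_in_map e]; apply/eqP/permP => j.
by apply: e; rewrite mem_index_enum.
Qed.

Lemma multilinear_polyE (B : algType K) (x : 'I_n -> B) :
  ncpoly_eval multilinear_poly x = \sum_sg al sg *: \prod_(i <- perm_seq sg) x i.
Proof.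
rewrite /ncpoly_eval raddf_sum; apply: eq_bigr => sg _.
by rewrite /= mmapU /= mulr_algl.
Qed.

(** Expanding the arguments on the monomials reduces an identity to the
    monomials; by multilinearity the coefficients come out of each term in the
    same way whatever the permutation is. *)
Lemma multilinear_poly_mon :
  (forall m : 'I_n -> M,
    \sum_sg al sg *: mon K (\big[mmul/mone]_(i <- perm_seq sg) m i) = 0) ->
  forall x : 'I_n -> A, ncpoly_eval multilinear_poly x = 0.
Proof.
move=> vanish x; rewrite multilinear_polyE.
pose D : {fset M} := (\bigcup_(i <- enum 'I_n) msupp (x i))%fset.
pose c i (e : D) : K := mcoeff (val e) (x i).
have xE i : x i = \sum_(e : D) c i e *: mon K (val e).
  rewrite -(big_seq_fsetE _ _ xpredT (fun m => mcoeff m (x i) *: mon K m)) /=.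
  rewrite {1}(@monalgEw _ _ (x i) D); last first.
    by rewrite /D; apply: (@bigfcup_sup _ _ (enum 'I_n) i xpredT (fun j => msupp (x j))); rewrite ?mem_enum.
  apply: eq_bigr => m _; apply/malgP => m'.
  by rewrite mcoeffZ !mcoeffU mulrnAr mulr1.
have prodE (sg : 'S_n) : \prod_(i <- perm_seq sg) x i =
    \sum_(h : {ffun 'I_n -> D}) (\prod_i c i (h i)) *:
      mon K (\big[mmul/mone]_(i <- perm_seq sg) val (h i)).
  rewrite big_map /=.
  under eq_bigr => j _ do rewrite xE.
  rewrite bigA_distr_bigA.
  pose per (h : {ffun 'I_n -> D}) : {ffun 'I_n -> D} := [ffun j => h (sg j)].
  have per_inj : injective per.
    move=> h1 h2 /ffunP e; apply/ffunP => i.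
    by have := e (sg^-1%g i); rewrite !ffunE permKV.
  rewrite (reindex_inj per_inj); apply: eq_bigr => h _ /=.
  rewrite scaler_prod -mon_prod big_map /=; congr (_ *: _).
    rewrite [RHS](reindex_inj (@perm_inj _ sg)).
    by apply: eq_bigr => j _; rewrite ffunE.
  by apply: eq_bigr => j _; rewrite ffunE.
under eq_bigr => sg _ do rewrite prodE scaler_sumr.
rewrite exchange_big big1 //= => h _.
under eq_bigr => sg _ do rewrite scalerA mulrC -scalerA.
by rewrite -scaler_sumr vanish scaler0.
Qed.

End Multilinear.

(** Write m i = zeta (l i) * phi (tau i).  The product of the m i in the order sg
    depends on sg only through [key tau sg], that is, through the permutations
    which move the normal elements to the front and the order of the remaining
    factors.  Asking that the coefficients add up to 0 over each value of the
    key, for each tau, gives (size F) ^ n * (#|{ffun I -> I}| * size F) ^ n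
    linear equations in n! unknowns. *)
Lemma normal_gen_PI : is_PI K A.
Proof.
pose T := 'I_(size F); pose phi (t : T) : M := nth mone F t.
have [n nc] := fact_gt_exp (size F * (#|{ffun I -> I}| * size F)).
pose keyT := ({ffun 'I_n -> {ffun I -> I}} * {ffun 'I_n -> T})%type.
pose E := ({ffun 'I_n -> T} * keyT)%type.
pose key (tau : {ffun 'I_n -> T}) (sg : 'S_n) : keyT :=
  ([ffun j => finfun (twist (phi \o tau) (perm_seq sg) j)],
   [ffun i => tau (sg i)]).
pose Mx : 'M[K]_(#|{perm 'I_n}|, #|{: E}|) :=
  \matrix_(i, j) (key (enum_val j).1 (enum_val i) == (enum_val j).2)%:R.
have [a a0 aM] : exists2 a : 'rV_#|{perm 'I_n}|, a != 0 & a *m Mx = 0.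
  exists (nz_row (kermx Mx)); last by apply/sub_kermxP/nz_row_sub.
  rewrite nz_row_eq0 kermx_eq0 -row_leq_rank -ltnNge.
  apply: leq_ltn_trans (rank_leq_col _) _.
  rewrite card_Sn !card_prod !card_ffun !card_ord -!expnMn.
  by rewrite card_ffun in nc.
pose al (sg : 'S_n) : K := a 0 (enum_rank sg).
have alE tau kp : \sum_(sg | key tau sg == kp) al sg = 0.
  have := congr1 (fun v : 'rV_#|{: E}| => v 0 (enum_rank (tau, kp))) aM.
  rewrite !mxE => e; rewrite -[RHS]e big_mkcond (reindex _ (onW_bij _ (@enum_val_bij _))) /=.
  apply: eq_bigr => j _; rewrite !mxE enum_rankK /al enum_valK.
  by case: eqP => _; rewrite ?mulr1 ?mulr0.
exists n, (multilinear_poly al); split.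
  have [j aj] : exists j, a 0 j != 0 by apply/rV0Pn.
  by apply: (@multilinear_poly_neq0 _ _ (enum_val j)); rewrite /al enum_valK.
apply: multilinear_poly_mon => m.
have nf i : exists lt : seq I * T, m i = mmul (zeta lt.1) (phi lt.2).
  have [l [f [/(nthP mone)[k kF kf] mf]]] := normal_form (m i).
  by exists (l, Ordinal kF); rewrite mf -kf.
have {nf}[lt ltE] := choice nf.
pose l i := (lt i).1; pose tau := [ffun i => (lt i).2].
pose Psi (kp : keyT) : M :=
  mmul (zeta (flatten [seq map (kp.1 j) (l j) | j <- index_enum 'I_n]))
       (\big[mmul/mone]_(j <- index_enum 'I_n) phi (kp.2 j)).
have PsiE sg : \big[mmul/mone]_(i <- perm_seq sg) m i = Psi (key tau sg).
  have usg : uniq (perm_seq sg) by rewrite map_inj_uniq ?index_enum_uniq //; apply: perm_inj.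
  transitivity (\big[mmul/mone]_(i <- perm_seq sg) mmul (zeta (l i)) ((phi \o tau) i)).
    by apply: eq_bigr => i _; rewrite ltE /= ffunE.
  rewrite prod_normal_form //; congr mmul; last first.
    by rewrite big_map; apply: eq_bigr => j _; rewrite ffunE.
  apply: zeta_perm; rewrite (@perm_trans _ (flatten [seq map (twist (phi \o tau)
      (perm_seq sg) j) (l j) | j <- index_enum 'I_n])) //.
    apply/perm_flatten/perm_map/uniq_perm => //; first exact: index_enum_uniq.
    move=> i; rewrite mem_index_enum; apply/mapP; exists (sg^-1%g i).
      by rewrite mem_index_enum.
    by rewrite permKV.
  rewrite (_ : [seq _ | j <- _] = [seq map ((key tau sg).1 j) (l j) | j <- index_enum 'I_n]) //.
  apply: eq_map => j; apply: eq_map => i /=; by rewrite !ffunE.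
under eq_bigr => sg _ do rewrite PsiE.
rewrite (partition_big (key tau) xpredT) //= big1 // => kp _.
rewrite (eq_bigr (fun sg => al sg *: mon K (Psi kp))); last by move=> sg /eqP->.
by rewrite -scaler_suml alE scale0r.
Qed.

End NormalGen.

(** * Growth rates *)

Section LimSup.
Variable R : realType.
Implicit Types (u v : nat -> \bar R).
Local Open Scope ereal_scope.

Lemma tail_nbhs N : \oo [set n | (N <= n)%N].
Proof. by exists N. Qed.

Lemma limn_esup_le_tail u (c : \bar R) N :
  (forall n, (N <= n)%N -> u n <= c) -> limn_esup u <= c.
Proof.
move=> uc; apply: (@le_trans _ _ (ereal_sup (u @` [set n | (N <= n)%N]))).
  by apply: ereal_inf_lbound; exists [set n | (N <= n)%N] => //; apply: tail_nbhs.
by apply: ge_ereal_sup => _ [n /= Nn <-]; apply: uc.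
Qed.

Lemma le_limn_esup u v N : (forall n, (N <= n)%N -> u n <= v n) ->
  limn_esup u <= limn_esup v.
Proof.
move=> uv; apply: le_ereal_inf_tmp => _ [W Woo <-].
apply: (@le_trans _ _ (ereal_sup (u @` (W `&` [set n | (N <= n)%N])))).
  apply: ereal_inf_lbound; exists (W `&` [set n | (N <= n)%N]) => //.
  by apply: filterI => //; apply: tail_nbhs.
apply: ge_ereal_sup => _ [n [Wn /= Nn] <-]; apply: le_trans (uv n Nn) _.
by apply: ereal_sup_ubound; exists n.
Qed.

Lemma limn_esup_ge_tail u (c : \bar R) N :
  (forall n, (N <= n)%N -> c <= u n) -> c <= limn_esup u.
Proof.
move=> cu; apply: le_ereal_inf_tmp => _ [W Woo <-].
have [n [Wn /= Nn]] : W `&` [set n | (N <= n)%N] !=set0.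
  have /filter_ex[n Hn] : \oo (W `&` [set n | (N <= n)%N]).
    by apply: filterI => //; apply: tail_nbhs.
  by exists n.
by apply: le_trans (cu n Nn) _; apply: ereal_sup_ubound; exists n.
Qed.

Lemma limn_esupD_cst u (c : R) :
  limn_esup (fun n => u n + c%:E) <= limn_esup u + c%:E.
Proof.
rewrite -leeBlDr //; apply: le_ereal_inf_tmp => _ [W Woo <-]; rewrite leeBlDr //.
apply: (@le_trans _ _ (ereal_sup ((fun n => u n + c%:E) @` W))).
  by apply: ereal_inf_lbound; exists W.
apply: ge_ereal_sup => _ [n Wn <-]; rewrite leeD2r //.
by apply: ereal_sup_ubound; exists n.
Qed.

End LimSup.

Section GrowthRate.
Variable R : realType.
Implicit Types (a b : nat -> nat).

Definition growth_rate a : \bar R :=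
  limn_esup (fun n => (ln (a n)%:R / ln (n%:R : R))%:E).

Lemma ln_nat_ge0 n : 0 <= ln (n%:R : R).
Proof. by case: n => [|n]; [rewrite ln0|apply: ln_ge0; rewrite ler1n]. Qed.

Lemma ln_nat_gt0 n : (1 < n)%N -> 0 < ln (n%:R : R).
Proof. by move=> n1; apply: ln_gt0; rewrite ltr1n. Qed.

Lemma ler_ln_nat m n : (m <= n)%N -> ln (m%:R : R) <= ln (n%:R : R).
Proof.
case: m => [|m] mn; first by rewrite ln0 ?ln_nat_ge0.
by rewrite ler_ln ?posrE ?ltr0n ?ler_nat //; apply: leq_trans mn.
Qed.

Lemma growth_rate_ge0 a : (0 <= growth_rate a)%E.
Proof.
apply: (@limn_esup_ge_tail _ _ _ 0%N) => n _.
by rewrite lee_fin divr_ge0 ?ln_nat_ge0.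
Qed.

Lemma growth_rate_le a b : (forall n, (a n <= b n)%N) ->
  (growth_rate a <= growth_rate b)%E.
Proof.
move=> ab; apply: (@le_limn_esup _ _ _ 0%N) => n _.
by rewrite lee_fin ler_wpM2r ?invr_ge0 ?ln_nat_ge0 ?ler_ln_nat.
Qed.

(** A constant factor d contributes ln d / ln n, which tends to 0. *)
Lemma growth_rate_leM d a b : (forall n, (0 < n)%N -> (0 < b n)%N) ->
  (forall n, (0 < n)%N -> (a n <= d * b n)%N) ->
  (growth_rate a <= growth_rate b)%E.
Proof.
move=> b0 ab; apply/lee_addgt0Pr => e e0.
apply: le_trans (limn_esupD_cst _ _).
set N := maxn 2 (Num.truncn (expR (ln (d%:R : R) / e))).+1.
apply: (@le_limn_esup _ _ _ N) => n; rewrite geq_max => /andP[n1 Nn].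
have en : ln (d%:R : R) <= e * ln n%:R.
  rewrite mulrC -ler_pdivrMr // -ler_expR lnK ?posrE ?ltr0n ?(ltnW n1) //.
  by apply/ltW/(lt_le_trans (truncnS_gt _)); rewrite ler_nat.
rewrite -EFinD lee_fin ler_pdivrMr ?ln_nat_gt0 // mulrDl mulfVK; last first.
  by rewrite gt_eqF ?ln_nat_gt0.
apply: le_trans (ler_ln_nat (ab n (ltnW n1))) _.
have [->|d0] := posnP d.
  by rewrite mul0n ln0 // addr_ge0 ?mulr_ge0 ?ln_nat_ge0 // ltW.
by rewrite natrM lnM ?posrE ?ltr0n ?b0 ?(ltnW n1) // addrC lerD2l.
Qed.

Lemma growth_rate_expn k : (growth_rate (fun n => n ^ k)%N = k%:R%:E)%E.
Proof.
have e n : (1 < n)%N -> ln ((n ^ k)%:R : R) / ln (n%:R : R) = k%:R.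
  move=> n1; rewrite natrX lnXn ?ltr0n ?(ltnW n1) // -[ln _ *+ k]mulr_natl mulfK //.
  by rewrite gt_eqF // ln_nat_gt0.
apply/eqP; rewrite eq_le; apply/andP; split.
  by apply: (@limn_esup_le_tail _ _ _ 2) => n n2; rewrite e.
by apply: (@limn_esup_ge_tail _ _ _ 2) => n n2; rewrite e.
Qed.

End GrowthRate.

(** * Gelfand-Kirillov dimension of the algebra of a graded monoid *)

Section LinearDimension.
Variables (K : fieldType) (A : algType K).
Implicit Types (V W S : set A).

Lemma lspan_range n (f : 'I_n -> A) x :
  lspan (range f) x <-> exists c : 'I_n -> K, x = \sum_i c i *: f i.
Proof.
split=> [[m [c [a [fa ->]]]]|[c ->]]; last by exists n, c, f; split=> // i; exists i.
have [j ja] : {j : 'I_m -> 'I_n & forall i, f (j i) = a i}.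
  by apply: (@choice _ _ (fun i k => f k = a i)) => i; have [k _ <-] := fa i; exists k.
exists (fun k => \sum_(i | j i == k) c i).
rewrite (partition_big j xpredT) //=; apply: eq_bigr => k _.
by rewrite scaler_suml; apply: eq_bigr => i /eqP <-; rewrite ja.
Qed.

Lemma lin_indep_leq n m (e : 'I_n -> A) (f : 'I_m -> A) : lin_indep e ->
  (forall i, lspan (range f) (e i)) -> (n <= m)%N.
Proof.
move=> ie ef.
have [C CE] : {C : 'I_n -> 'I_m -> K & forall i, e i = \sum_j C i j *: f j}.
  apply: (@choice _ _ (fun i (c : 'I_m -> K) => e i = \sum_j c j *: f j)) => i.
  exact/lspan_range.
pose Mx := \matrix_(i, j) C i j.
suff : row_free Mx by rewrite -row_leq_rank => /leq_trans; apply; apply: rank_leq_col.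
rewrite -kermx_eq0; apply/negPn/negP => /negPf kn0.
have v0 : nz_row (kermx Mx) != 0 by rewrite nz_row_eq0 kn0.
have vM : nz_row (kermx Mx) *m Mx = 0 by apply/sub_kermxP/nz_row_sub.
move: (nz_row _) v0 vM => v /rV0Pn[i vi] vM; case/eqP: vi.
apply: (ie (fun i => v 0 i)).
transitivity (\sum_j (v *m Mx) 0 j *: f j).
  under eq_bigr => k _ do rewrite CE scaler_sumr.
  rewrite exchange_big; apply: eq_bigr => j _; rewrite mxE scaler_suml.
  by apply: eq_bigr => k _; rewrite mxE scalerA.
by rewrite vM big1 // => j _; rewrite mxE scale0r.
Qed.

Lemma has_dim_leq V W n m : V `<=` W -> has_dim V n -> has_dim W m -> (n <= m)%N.
Proof.
move=> VW [e [ie eV]] [f [_ fW]]; apply: (lin_indep_leq (f := f) ie) => i.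
rewrite fW; apply: VW; rewrite -eV; apply/lspan_range.
exists (fun j => (j == i)%:R); rewrite (bigD1 i) //= eqxx scale1r big1 ?addr0 //.
by move=> j /negPf->; rewrite scale0r.
Qed.

(** When V has no finite dimension, the bound holds because [ldim] is then 0. *)
Lemma ldim_leq V W m : V `<=` W -> has_dim W m -> (ldim V <= m)%N.
Proof.
move=> VW dW; rewrite /ldim; case: xgetP => [n _ dV|//].
exact: has_dim_leq VW dV dW.
Qed.

Lemma has_dimE V n : has_dim V n -> ldim V = n.
Proof.
move=> dV; have ldV : has_dim V (ldim V) by apply: xgetPex; exists n.
by apply/eqP; rewrite eqn_leq (has_dim_leq _ ldV dV) ?(has_dim_leq _ dV ldV).
Qed.

Lemma lspan_sub S W : S `<=` W -> W 0 ->
  (forall (c : K) x y, W x -> W y -> W (c *: x + y)) -> lspan S `<=` W.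
Proof.
move=> SW W0 WD _ [n [c [a [Sa ->]]]].
elim/big_ind : _ => // [x y Wx Wy|i _]; first by rewrite -[x]scale1r; apply: WD.
by rewrite -[_ *: _]addr0; apply: WD => //; apply: SW.
Qed.

Lemma lspan0 S : lspan S 0.
Proof. by exists 0%N, (fun=> 0), (fun=> 0); split=> [[]|]//; rewrite big_ord0. Qed.

Lemma lspanD S (c : K) x y : S x -> lspan S y -> lspan S (c *: x + y).
Proof.
move=> Sx [n [d [a [Sa ->]]]].
exists n.+1, (fun i => oapp d c (unlift ord0 i)), (fun i => oapp a x (unlift ord0 i)).
split=> [i|]; first by case: unliftP => [j _|_] /=.
rewrite big_ord_recl unlift_none; congr (_ + _).
by apply: eq_bigr => i _; rewrite liftK.
Qed.

Lemma lspan_closed S (c : K) x y : lspan S x -> lspan S y -> lspan S (c *: x + y).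
Proof.
move=> [n [d [a [Sa ->]]]] Sy; rewrite scaler_sumr.
elim/big_rec: _ => [|i s _ IH]; first by rewrite add0r.
by rewrite scalerA -addrA; apply: lspanD.
Qed.

End LinearDimension.

Section MonomialSpan.
Variables (K : fieldType) (M : monomType).
Notation A := (monoid_algebra K M).
Implicit Types (D : {fset M}).

Definition mspan D : set A := [set x : A | (msupp x `<=` D)%fset].

Lemma mspanP D (x : A) : mspan D x <-> forall m, m \notin D -> mcoeff m x = 0.
Proof.
split=> [/fsubsetP xD m mD|xD].
  by apply: mcoeff_outdom; apply: contra mD; apply: xD.
apply/fsubsetP => m; apply: contraLR => /xD e.
by rewrite -mcoeff_eq0 e.
Qed.

Lemma mspan0 D : mspan D 0.
Proof. by apply/mspanP => m _; rewrite mcoeff0. Qed.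

Lemma mspanD D (c : K) (x y : A) : mspan D x -> mspan D y -> mspan D (c *: x + y).
Proof.
move=> /mspanP xD /mspanP yD; apply/mspanP => m mD.
by rewrite mcoeffD mcoeffZ xD // yD // mulr0 addr0.
Qed.

Lemma mspan_mon D m : m \in D -> mspan D (mon K m).
Proof.
move=> mD; apply/mspanP => m' mD'; rewrite mcoeff_mon.
by case: eqP mD' => // <-; rewrite mD.
Qed.

Lemma mspan_lspan D : lspan (mon K @` [set m | m \in D]) = mspan D.
Proof.
apply/seteqP; split.
  apply: lspan_sub; [|exact: mspan0|exact: mspanD].
  by move=> _ [m mD <-]; apply: mspan_mon.
move=> x /fsubsetP xD; rewrite [x]monE.
have : {subset enum_fset (msupp x) <= D} by [].
elim: (enum_fset _) => [|m r IH] rD; first by rewrite big_nil; apply: lspan0.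
rewrite big_cons; apply: lspanD; first by exists m => //; apply: rD; rewrite mem_head.
by apply: IH => m' m'r; apply: rD; rewrite inE m'r orbT.
Qed.

(** This reduces the growth of the algebra to that of the monoid. *)
Lemma has_dim_mspan D : has_dim (mspan D) #|` D|.
Proof.
rewrite cardfE; exists (fun i => mon K (val (enum_val i : D))); split.
  move=> c e i; have := congr1 (mcoeff (val (enum_val i))) e.
  rewrite mcoeff0 raddf_sum /= (bigD1 i) //= mcoeffZ mcoeff_mon eqxx mulr1 big1 ?addr0 //.
  move=> j ji; rewrite mcoeffZ mcoeff_mon (inj_eq val_inj) (inj_eq enum_val_inj).
  by rewrite (negPf ji) mulr0.
rewrite -mspan_lspan; congr lspan; apply/seteqP; split=> [_ [i _ <-]|_ [m mD <-]].
  by exists (val (enum_val i)) => //=; apply: fsvalP.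
by exists (enum_rank [` mD]%fset) => //; rewrite enum_rankK.
Qed.

End MonomialSpan.
Arguments mspan K {M} D _.

(** A length function on [M] generated in degree one, with finite balls. *)
Definition graded_by (M : monomType) (len : M -> nat) (ball : nat -> {fset M}) : Prop :=
  [/\ len mone = 0%N, forall x y, len (mmul x y) = (len x + len y)%N,
      forall m, len m = 0%N -> m = mone,
      forall m a b, len m = (a + b)%N ->
        exists x y, [/\ m = mmul x y, len x = a & len y = b] &
      forall n m, (m \in ball n) = (len m <= n)%N].

Section GradedGrowth.
Variables (R : realType) (K : fieldType) (M : monomType).
Variables (len : M -> nat) (ball : nat -> {fset M}).
Hypothesis gM : graded_by len ball.
Notation A := (monoid_algebra K M).

Let ballE n m : (m \in ball n) = (len m <= n)%N.
Proof. by case: gM. Qed.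

Let lenM x y : len (mmul x y) = (len x + len y)%N.
Proof. by case: gM. Qed.

Let len1 : len mone = 0%N.
Proof. by case: gM. Qed.

Lemma ball_gt0 n : (0 < #|` ball n|)%N.
Proof. by rewrite cardfs_gt0; apply/fset0Pn; exists mone; rewrite ballE len1. Qed.

Lemma mspanM a b (x y : A) : mspan K (ball a) x -> mspan K (ball b) y ->
  mspan K (ball (a + b)) (x * y).
Proof.
move=> /fsubsetP xa /fsubsetP yb; apply/fsubsetP => m /(fsubsetP (msuppM_incl _ _)).
move=> /imfset2P[m1 m1x [m2 m2y ->]]; rewrite ballE lenM leq_add //.
  by rewrite -ballE; apply: xa.
by rewrite -ballE; apply: yb.
Qed.

Lemma mspan_ball_le a b : (a <= b)%N -> mspan K (ball a) `<=` mspan K (ball b).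
Proof.
move=> ab x /fsubsetP xa; apply/fsubsetP => m /xa; rewrite !ballE => ma.
exact: leq_trans ab.
Qed.

Lemma pow_sum_sub s (V : set A) n : V `<=` mspan K (ball s) ->
  pow_sum V n `<=` mspan K (ball (s * n)).
Proof.
move=> Vs; apply: lspan_sub; [|exact: mspan0|exact: mspanD].
move=> _ [l [ln lV ->]]; apply: (@mspan_ball_le (s * size l)).
  by rewrite leq_mul2l ln orbT.
elim: l lV {ln} => [|x l IH] lV.
  by rewrite big_nil -mon1; apply: mspan_mon; rewrite ballE len1.
rewrite big_cons /= mulnS; apply: mspanM.
  by apply/Vs/lV; rewrite mem_head.
by apply: IH => y yl; apply: lV; rewrite inE yl orbT.
Qed.

(** The balls are generated by those of small radius, because every element
    factors with prescribed lengths. *)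
Lemma pow_sum_ball s n : pow_sum (mspan K (ball s)) n = mspan K (ball (s * n)).
Proof.
apply/seteqP; split; first exact: pow_sum_sub.
rewrite -mspan_lspan; apply: lspan_sub; first last.
- by move=> c x y; apply: lspan_closed.
- exact: lspan0.
move=> _ [m mb <-]; rewrite -[mon K m]addr0 -[mon K m]scale1r.
apply: lspanD; last exact: lspan0; move: mb; rewrite /= ballE.
have [_ _ len0 split _] := gM.
elim: n m => [|n IH] m mb.
  exists [::]; split=> //; rewrite big_nil; move: mb; rewrite muln0 leqn0 => /eqP/len0->.
  by rewrite mon1.
have [ms|sm] := leqP (len m) s.
  exists [:: mon K m]; split=> //; last by rewrite big_seq1.
  by move=> y; rewrite inE => /eqP->; apply: mspan_mon; rewrite ballE.
have [x [y [em lx ly]]] := split m s (len m - s)%N (esym (subnKC (ltnW sm))).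
have [|l [ln lV ey]] := IH y; first by rewrite ly leq_subLR -mulnS.
exists (mon K x :: l); split=> //; last by rewrite em monM big_cons ey.
move=> z; rewrite inE => /orP[/eqP->|/lV//].
by apply: mspan_mon; rewrite ballE lx.
Qed.

Lemma fin_dim_sub_ball (V : set A) : fin_dim V -> exists s, V `<=` mspan K (ball s).
Proof.
move=> [n [e [_ <-]]].
exists (\max_i \max_(m <- msupp (e i)) len m)%N.
apply: lspan_sub; [|exact: mspan0|exact: mspanD].
move=> _ [i _ <-]; apply/fsubsetP => m mi; rewrite ballE.
apply: leq_trans (leq_bigmax i).
by rewrite (big_rem m) //= leq_maxl.
Qed.

(** A finite-dimensional subspace lies in the span of a ball of some radius s,
    and its n-th power sum in the span of the ball of radius s n. *)
Lemma GKdimE : GKdim R K A =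
  ereal_sup (range (fun s => growth_rate R (fun n => #|` ball (s * n)|))).
Proof.
apply/eqP; rewrite eq_le; apply/andP; split.
  apply: ge_ereal_sup => _ [V /fin_dim_sub_ball[s Vs] <-].
  apply: (@le_trans _ _ (growth_rate R (fun n => #|` ball (s * n)|))).
    apply: growth_rate_le => n; apply: ldim_leq (pow_sum_sub Vs) _.
    exact: has_dim_mspan.
  by apply: ereal_sup_ubound; exists s.
apply: ge_ereal_sup => _ [s _ <-]; apply: ereal_sup_ubound.
exists (mspan K (ball s)); first by exists #|` ball s|; apply: has_dim_mspan.
rewrite /growth_rate; congr limn_esup; apply/funext => n.
by rewrite pow_sum_ball (has_dimE (has_dim_mspan _ _)).
Qed.

Lemma GKdim_ge0 : (0 <= GKdim R K A)%E.
Proof.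
rewrite GKdimE; apply: le_trans (growth_rate_ge0 R (fun n => #|` ball (0 * n)|)) _.
by apply: ereal_sup_ubound; exists 0%N.
Qed.

Lemma GKdim_le_poly d k : (forall n, #|` ball n| <= d * n.+1 ^ k)%N ->
  (GKdim R K A <= (k%:R)%:E)%E.
Proof.
move=> bd; rewrite GKdimE; apply: ge_ereal_sup => _ [s _ <-].
rewrite -(growth_rate_expn R k).
apply: (@growth_rate_leM _ (d * s.+1 ^ k)%N).
  by move=> n n0; rewrite expn_gt0 n0.
move=> n n0; apply: leq_trans (bd _) _; rewrite -mulnA leq_mul2l -expnMn.
apply/orP; right; have [->//|k0] := posnP k.
by rewrite leq_exp2r // mulSn -add1n leq_add2r.
Qed.

Lemma GKdim_ge_poly s k : (forall n, n ^ k <= #|` ball (s * n)|)%N ->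
  ((k%:R)%:E <= GKdim R K A)%E.
Proof.
move=> bd; rewrite GKdimE -(growth_rate_expn R k).
apply: le_trans (growth_rate_le R bd) _.
by apply: ereal_sup_ubound; exists s.
Qed.

End GradedGrowth.

(** The bound holds for each radius, with the same radius on both sides. *)
Lemma GKdim_leM (R : realType) (K : fieldType) (M M' : monomType) len len' ball ball' d :
  @graded_by M len ball -> @graded_by M' len' ball' ->
  (forall n, #|` ball n| <= d * #|` ball' n|)%N ->
  (GKdim R K (monoid_algebra K M) <= GKdim R K (monoid_algebra K M'))%E.
Proof.
move=> gM gM' bb; rewrite (GKdimE R K gM) (GKdimE R K gM').
apply: ge_ereal_sup => _ [s _ <-].
apply: (@le_trans _ _ (growth_rate R (fun n => #|` ball' (s * n)|))).
  by apply: growth_rate_leM => n *; [apply: ball_gt0 gM' _|apply: bb].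
by apply: ereal_sup_ubound; exists s.
Qed.

(** * The structure monoid of a left semi-brace *)

Section StructGraded.
Variables (X : finType) (r : X * X -> X * X).
Notation M := (struct_monoid r).

Definition word_len (m : M) : nat := size (generic_quotient.repr m).

Lemma word_len_word w : word_len (struct_word r w) = size w.
Proof.
by apply/(word_cong_size (r := r))/struct_wordP; rewrite struct_wordK.
Qed.

Definition word_ball n : {fset M} :=
  [fset struct_word r (bseqval w) | w in {: n.-bseq X}]%fset.

Lemma in_word_ball n m : (m \in word_ball n) = (word_len m <= n)%N.
Proof.
apply/imfsetP/idP => [[w _ ->]|mn]; first by rewrite word_len_word size_bseq.
by exists (Bseq mn) => //=; rewrite struct_wordK.
Qed.

Lemma struct_graded : graded_by word_len word_ball.
Proof.
split=> [|x y|m /size0nil m0|m a b mab|n m]; last exact: in_word_ball.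
- exact: (word_len_word [::]).
- exact: etrans (word_len_word _) (size_cat _ _).
- by rewrite -[m]struct_wordK m0.
exists (struct_word r (take a (generic_quotient.repr m))).
exists (struct_word r (drop a (generic_quotient.repr m))); split.
- by rewrite [RHS]struct_mul_word cat_take_drop struct_wordK.
- by rewrite word_len_word size_takel // -/(word_len m) mab leq_addr.
- by rewrite word_len_word size_drop -/(word_len m) mab addKn.
Qed.

End StructGraded.

Section FsetCard.
Variables (T : finType) (X : choiceType) (f : T -> X) (D : {fset X}).

Lemma card_fset_cover : (forall x, x \in D -> exists t, f t = x) ->
  (#|` D| <= #|T|)%N.
Proof.
move=> fD; pose E := [fset f t | t in {: T}]%fset.
apply: (@leq_trans #|` E|); last by rewrite cardE; apply: leq_imfset_card.
by apply/fsubset_leq_card/fsubsetP => x /fD[t <-]; apply/imfsetP; exists t.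
Qed.

Lemma card_fset_inj : injective f -> (forall t, f t \in D) -> (#|T| <= #|` D|)%N.
Proof.
move=> finj fD; pose E := [fset f t | t in {: T}]%fset.
have -> : #|T| = #|` E| by rewrite card_imfset //= -cardE.
by apply/fsubset_leq_card/fsubsetP => _ /imfsetP[t _ ->].
Qed.

End FsetCard.

Section CountLists.
Variable I : finType.

Definition of_mult (al : I -> nat) : seq I := flatten [seq nseq (al i) i | i <- enum I].

Lemma count_of_mult al i : count_mem i (of_mult al) = al i.
Proof.
rewrite count_flatten sumnE !big_map -enumT big_enum /= (bigD1 i) //= big1.
  by rewrite count_nseq /= eqxx mul1n addn0.
by move=> j /negPf ji; rewrite count_nseq /= ji.
Qed.

Lemma size_of_mult al n : (forall i, al i <= n)%N -> (size (of_mult al) <= #|I| * n)%N.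
Proof.
move=> aln; rewrite size_flatten sumnE !big_map -enumT big_enum /= -sum_nat_const.
by apply: leq_sum => i _; rewrite size_nseq.
Qed.

Lemma perm_of_mult l : perm_eq l (of_mult (fun i => count_mem i l)).
Proof. by apply/allP => i _ /=; rewrite count_of_mult. Qed.

End CountLists.

(** An element zeta l * f of length at most n is determined by f and by the
    multiplicities of the entries of l, each at most n. *)
Lemma normal_gen_ball (M : monomType) (I : finType) z s F len ball n :
  @normal_gen M I z s F -> graded_by len ball -> (forall i, 0 < len (z i))%N ->
  (#|` ball n| <= size F * n.+1 ^ #|I|)%N.
Proof.
move=> ng [len1 lenM _ _ ballE] zpos.
pose T := ('I_(size F) * {ffun I -> 'I_n.+1})%type.
pose f (p : T) : M := mmul (zeta z (of_mult (fun i => p.2 i : nat))) (nth mone F p.1).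
have lz l : (size l <= len (zeta z l))%N.
  by elim: l => //= i l IH; rewrite zeta_cons lenM -add1n leq_add.
have -> : (size F * n.+1 ^ #|I|)%N = #|{: T}|.
  by rewrite card_prod card_ffun !card_ord.
apply: (card_fset_cover (f := f)) => m; rewrite ballE => mn.
have [l [g [/(nthP mone)[k kF kg] mE]]] := normal_form ng m.
have ln i : (count_mem i l < n.+1)%N.
  rewrite ltnS; apply: leq_trans (count_size _ _) _; apply: leq_trans (lz l) _.
  by apply: leq_trans mn; rewrite mE lenM leq_addr.
exists (Ordinal kF, [ffun i => Ordinal (ln i)]); rewrite /f /= kg mE.
congr mmul; apply: (zeta_perm ng); rewrite perm_sym.
rewrite (permPl (perm_of_mult l)); apply/allP => i _ /=.
by rewrite !count_of_mult ffunE.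
Qed.

Section SemiBraceMonoid.
Variables (B : finLeftSemiBraceType).
Hypothesis rhoB : rho_antihom B.
Notation G := (corner_grp B).
Notation M := (sb_monoid B).
Notation cls := (struct_word (sb_r B)).

Definition central_gen (c : G) : M := cls (cblock c).

Definition monoid_act (m : M) : G -> G := lact (wprod (generic_quotient.repr m)).

Lemma mul_cls v w : mmul (cls v) (cls w) = cls (v ++ w).
Proof. exact: struct_mul_word. Qed.

Lemma wprod_repr w : wprod (generic_quotient.repr (cls w)) = wprod w.
Proof. by apply: wprod_cong; apply/struct_wordP; rewrite struct_wordK. Qed.

Lemma sb_monoid_normal_gen :
  normal_gen central_gen monoid_act
    (enum_fset (word_ball (sb_r B) (#|{: G}| * #|{: G}|))).
Proof.
split=> [m c|m|c d|P PF Pz m].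
- rewrite -[m]struct_wordK !mul_cls; apply/struct_wordP.
  rewrite /monoid_act wprod_repr; exact: cblock_normal.
- by apply: can_inj (lactK _).
- by rewrite /monoid_act wprod_repr wprod_cblock // lact1.
have [n] := ubnP (word_len m); elim: n m => // n IH m; rewrite ltnS => mn.
have [mF|Fm] := leqP (word_len m) (#|{: G}| * #|{: G}|).
  by apply: PF; rewrite in_word_ball.
have [c [w cw]] := cblock_extract rhoB Fm.
have em : m = mmul (central_gen c) (cls w).
  by rewrite -[m]struct_wordK mul_cls; apply/struct_wordP.
rewrite em; apply: Pz; apply: IH; apply: leq_trans mn.
rewrite [word_len m]( _ : _ = size (cblock c ++ w)); last exact: word_cong_size cw.
rewrite word_len_word size_cat size_cblock // -[(size w).+1]add1n leq_add2r.
by apply/card_gt0P; exists c.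
Qed.

(** By [last_letter] an element of M(B) is 1 or the product of an element coming
    from the corner and one letter of B. *)
Lemma ball_le_corner n :
  (#|` word_ball (sb_r B) n| <=
   #|B|.+1 * #|` word_ball (sb_r (corner_sb B)) n|)%N.
Proof.
set D := word_ball (sb_r (corner_sb B)) n.
pose f (p : option B * D) : M :=
  if p.1 is Some x then cls (rcons (map (@of_corner B) (generic_quotient.repr (val p.2))) x)
  else mone.
have -> : (#|B|.+1 * #|` D|)%N = #|{: option B * D}|.
  by rewrite card_prod card_option cardfE.
apply: (card_fset_cover (f := f)) => m; rewrite in_word_ball => mn.
have [w0|w0] := eqVneq (generic_quotient.repr m) [::].
  have D0 : struct_word (sb_r (corner_sb B)) [::] \in D.
    by rewrite in_word_ball word_len_word.
  by exists (None, [` D0]%fset); rewrite /f /= -[m]struct_wordK w0.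
have [a [x wx]] := last_letter rhoB w0.
set v := map (@in_corner B) (uncoord 1%g a).
have vD : struct_word (sb_r (corner_sb B)) v \in D.
  rewrite in_word_ball word_len_word; apply: leq_trans mn.
  by rewrite /word_len (word_cong_size wx) size_cat size_map leq_addr.
exists (Some x, [` vD]%fset); rewrite /f /= -cats1 -[m]struct_wordK.
apply/struct_wordP/(WCtrans _ (WCsym wx))/WCcat; last exact: WCrefl.
rewrite -[X in word_cong _ _ X](of_corner_map_in (uncoord_corner 1%g a)).
by apply/of_corner_cong/struct_wordP; rewrite struct_wordK.
Qed.

Lemma ball_corner_le n :
  (#|` word_ball (sb_r (corner_sb B)) n| <= #|` word_ball (sb_r B) n|)%N.
Proof.
pose f (m : sb_monoid (corner_sb B)) : M :=
  cls (map (@of_corner B) (generic_quotient.repr m)).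
have finj : injective f.
  move=> m m' /struct_wordP/(of_corner_inj rhoB)/struct_wordP.
  by rewrite !struct_wordK.
rewrite cardfE; apply: (card_fset_inj (f := f \o val)) => [|m].
  exact: inj_comp finj val_inj.
rewrite in_word_ball word_len_word size_map -/(word_len (val m)) -in_word_ball.
exact: fsvalP.
Qed.

(** Words whose coordinates take each value less than n times are distinguished
    by these multiplicities. *)
Lemma ball_ge_brace n : commutative (@sbmul B) ->
  (n ^ #|{: G}| <= #|` word_ball (sb_r B) (#|{: G}| * n)|)%N.
Proof.
move=> mC; pose f (al : {ffun G -> 'I_n}) : M := cls (uncoord 1%g (of_mult (fun c => al c : nat))).
have finj : injective f.
  move=> a b /struct_wordP/(coord_perm rhoB 1%g mC); rewrite !uncoordK.
  move=> /seq.permP ab; apply/ffunP => c; apply: val_inj.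
  by have := ab (pred1 c); rewrite !count_of_mult.
have -> : (n ^ #|{: G}|)%N = #|{: {ffun G -> 'I_n}}| by rewrite card_ffun card_ord.
apply: card_fset_inj finj _ => al.
rewrite in_word_ball word_len_word -(size_coord 1%g) uncoordK.
by apply: size_of_mult => c; apply: ltnW.
Qed.

End SemiBraceMonoid.

Theorem theorem5p8 (R : realType) (K : fieldType) (B : finLeftSemiBraceType)
    (rhoB : rho_antihom B) :
  [/\ left_noetherian (monoid_algebra K (sb_monoid B)),
      right_noetherian (monoid_algebra K (sb_monoid B)) &
      is_PI K (monoid_algebra K (sb_monoid B))] /\
  [/\ GKdim R K (monoid_algebra K (sb_monoid B)) \is a fin_num,
      GKdim R K (monoid_algebra K (sb_monoid B)) =
        GKdim R K (monoid_algebra K (sb_monoid (corner_sb B))),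
      (GKdim R K (monoid_algebra K (sb_monoid B)) <= (#|corner B|%:R)%:E)%E &
      is_left_brace B ->
        GKdim R K (monoid_algebra K (sb_monoid B)) = (#|corner B|%:R)%:E].
Proof.
have ng := sb_monoid_normal_gen rhoB.
have gB := struct_graded (sb_r B); have gD := struct_graded (sb_r (corner_sb B)).
have zpos c : (0 < word_len (central_gen (B := B) c))%N.
  by rewrite word_len_word size_cblock; apply/card_gt0P; exists c.
have le_corner : (GKdim R K (monoid_algebra K (sb_monoid B)) <= (#|corner B|%:R)%:E)%E.
  rewrite -card_corner_grp; apply: (GKdim_le_poly R K gB) => n.
  exact: normal_gen_ball ng gB zpos.
split; split.
- exact: normal_gen_left_noetherian ng.
- exact: normal_gen_right_noetherian ng.
- exact: normal_gen_PI ng.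
- rewrite ge0_fin_numE; first exact: le_lt_trans le_corner (ltry _).
  exact: GKdim_ge0 gB.
- apply/eqP; rewrite eq_le; apply/andP; split.
    exact: (GKdim_leM R K gB gD (ball_le_corner rhoB)).
  apply: (GKdim_leM (d := 1) R K gD gB) => n.
  by rewrite mul1n; apply: ball_corner_le.
- by [].
move=> [mC _]; apply/eqP; rewrite eq_le le_corner /= -card_corner_grp.
exact: (GKdim_ge_poly R K gB) (fun n => ball_ge_brace rhoB n mC).
Qed.
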